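(* Let $m\ge1$ be an integer, let $f(z)=\sum_{k=0}^\infty a_kz^k\in H^\infty(\mathbb{D})$, $g(z)=\sum_{k=0}^\infty d_kz^k\in L^2_a(\mathbb{D})$ and $h(z)=\sum_{k=0}^\infty c_kz^k\in L^2_a(\mathbb{D})$. Write $g=g_0+g_1=g_0+z^mg_2$, where $g_0(z)=\sum_{k=0}^{m-1}d_kz^k$. The following conditions are equivalent: (1) $T_{\overline{z}^m+f}\,g=h$; (2) $\big[zg_1'-(m-1)g_1\big]+(m+1)z^m(fg-h)+z^{m+1}(fg-h)'=0$; (3) $\big(zg_2'+g_2\big)+(m+1)(fg)+z(fg)'=(m+1)h+zh'$; (4) $c_k=\dfrac{k+1}{m+k+1}d_{m+k}+\sum_{i=0}^ka_{k-i}d_i$ for $k=0,1,2,\dots$.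
   Context: $\mathbb{D}$ is the open unit disk in $\mathbb{C}$ and $dA$ is the normalized Lebesgue area measure on $\mathbb{D}$. The Bergman space $L^2_a(\mathbb{D})$ is the closed subspace of analytic functions in $L^2(\mathbb{D},dA)$, and $P:L^2(\mathbb{D},dA)\to L^2_a(\mathbb{D})$ is the orthogonal projection. For $\varphi\in L^\infty(\mathbb{D},dA)$ the Toeplitz operator is $T_\varphi u=P(\varphi u)$ on $L^2_a(\mathbb{D})$. $H^\infty(\mathbb{D})$ is the space of bounded analytic functions on $\mathbb{D}$. *)

(* Defs.v *)
From HB Require Import structures.
From mathcomp Require Import all_boot all_order all_algebra.
From mathcomp Require Import complex.
From mathcomp Require Import all_classical all_reals all_analysis.
Import Order.TTheory GRing.Theory Num.Theory numFieldNormedType.Exports.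

Set Implicit Arguments.
Unset Strict Implicit.
Unset Printing Implicit Defensive.

Local Open Scope classical_set_scope.
Local Open Scope ring_scope.

(* R[i] itself has no topology in the library. Packed as a numClosedFieldType,
   it gets the topology of the modulus and the structure of a normed module
   over itself, so that derivable and derive1 below are complex derivatives. *)
Definition Cx (R : realType) : numClosedFieldType := R[i].

Definition disk (R : realType) : set (Cx R) := [set z | `|z| < 1].
Arguments disk R _ : clear implicits.

(* Integration takes place on R * R with its product sigma-algebra;
   the pair p stands for the complex number p.1 + i p.2. *)
Definition plane (R : realType) (p : R * R) : Cx R := (p.1 +i* p.2)%C.

Definition plane_disk (R : realType) : set (R * R) := plane (R:=R) @^-1` disk R.
Arguments plane_disk R _ : clear implicits.

(* Plane Lebesgue measure divided by pi: the disk has mass 1. *)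
Definition dA (R : realType) :
    {measure set (measurableTypeR R * measurableTypeR R)%type -> \bar R} :=
  mscale (NngNum (ltW (divr_gt0 ltr01 (pi_gt0 R))))
    (@lebesgue_measure R \x @lebesgue_measure R)%E.
Arguments dA R : clear implicits.

Definition disk_measurable (R : realType) (u : Cx R -> Cx R) : Prop :=
  measurable_fun (plane_disk R) (fun p => complex.Re (u (plane p))) /\
  measurable_fun (plane_disk R) (fun p => complex.Im (u (plane p))).

Definition disk_integral (R : realType) (u : Cx R -> Cx R) : Cx R :=
  (Rintegral (dA R) (plane_disk R) (fun p => complex.Re (u (plane p)))
   +i* Rintegral (dA R) (plane_disk R) (fun p => complex.Im (u (plane p))))%C.

(* Functions on the disk are represented by total functions Cx R -> Cx R,
   whose values outside the disk are irrelevant. *)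
Definition L2_disk (R : realType) (u : Cx R -> Cx R) : Prop :=
  disk_measurable u /\
  (\int[dA R]_(p in plane_disk R) (complex.Re (`|u (plane p)| ^+ 2))%:E
     < +oo)%E.

Definition L2_inner (R : realType) (u v : Cx R -> Cx R) : Cx R :=
  disk_integral (fun z => u z * (v z)^*).

Definition analytic (R : realType) (u : Cx R -> Cx R) : Prop :=
  forall z : Cx R, disk R z -> derivable u z 1.

Definition bergman (R : realType) (u : Cx R -> Cx R) : Prop :=
  analytic u /\ L2_disk u.

Definition Hinfty (R : realType) (u : Cx R -> Cx R) : Prop :=
  analytic u /\ exists M : R, forall z : Cx R, disk R z -> `|u z| <= (M%:C)%C.

(* v is the orthogonal projection of u on the Bergman space: v belongs to it
   and u - v is orthogonal to it. On the disk there is at most one such v, and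
   there is one when u is in L2, so the default value of xget below plays no
   role for such u. *)
Definition is_bergman_projection (R : realType) (u v : Cx R -> Cx R) : Prop :=
  bergman v /\
  forall w, bergman w -> L2_inner (fun z => u z - v z) w = 0.

Definition bergman_projection (R : realType) (u : Cx R -> Cx R) :
    Cx R -> Cx R :=
  xget (fun=> 0) [set v | is_bergman_projection u v].

Definition toeplitz (R : realType) (phi u : Cx R -> Cx R) : Cx R -> Cx R :=
  bergman_projection (fun z => phi z * u z).

Definition power_series (R : realType) (a : nat -> Cx R) (u : Cx R -> Cx R) :
    Prop :=
  forall z : Cx R, disk R z -> series (fun k => a k * z ^+ k) @ \oo --> u z.

(* Main.v *)
(* Since f g lies in the Bergman space, T g = P(conj(z)^m g) + f g, and all four
   conditions become statements on Taylor coefficients once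
     P(conj(z)^m g) = G := sum_k (k+1)/(m+k+1) d_(m+k) z^k.
   Let gg and GG be the primitives of g and G vanishing at 0. For r < 1,
     Phi := conj(gg) z^m - r^(2m) conj(GG)
            - sum_(k < m) conj(d_k) r^(2k+2) / (k+1) z^(m-k-1)
   vanishes on |z| = r, so for w analytic the integral over |z| < r of
   dbar(w Phi) = w conj(conj(z)^m g - r^(2m) G) vanishes. As analytic only means
   complex differentiable, this divergence theorem is proved by Goursat's
   bisection. Taking w = G bounds the L2 norm of G, and r -> 1 gives
   the orthogonality of conj(z)^m g - G to the Bergman space. *)
Require Import Defs.
From mathcomp Require Import all_boot all_order all_algebra.
From mathcomp Require Import complex.
From mathcomp Require Import all_classical all_reals all_analysis.
From mathcomp Require Import measurable_realfun.
From mathcomp Require Import ring lra.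
Import Order.TTheory GRing.Theory Num.Theory numFieldNormedType.Exports.

Set Implicit Arguments.
Unset Strict Implicit.
Unset Printing Implicit Defensive.

Local Open Scope classical_set_scope.
Local Open Scope ring_scope.

(** Orthogonality has to be tested against every w of the Bergman space, and of such a w only
    complex differentiability is known: no Taylor expansion, no continuity of w'. This rules out
    computing with monomials in place of w. The product w Phi avoids both obstacles: w' enters only
    its derivative in z, while its derivative in conj z involves w, g and G themselves, which are
    continuous, and this is the only derivative that the divergence sees. To have no boundary curve,
    w Phi is extended by zero to a square containing the disk. The extension may fail to be
    differentiable on the circle, but it decays linearly there and the circle has area 0, so the
    squares meeting it cost arbitrarily little in the bisection. Integrals are handled through real
    parts; replacing w by i w recovers the imaginary parts. The limit r -> 1 comes last because
    boundedness of all the functions is available only on disks of radius less than 1. *)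

Definition cabs (R : realType) (z : Cx R) : R := ComplexField.Normc.normc z.

Lemma cabs_ge0 (R : realType) (z : Cx R) : 0 <= cabs z.
Proof. by case: z => a b; rewrite /cabs /= sqrtr_ge0. Qed.

#[local] Hint Extern 0 (is_true (_ <= cabs _)) =>
  solve [apply: cabs_ge0] : core.

(** * The real-valued modulus and first-order expansions *)

Section Modulus.
Variable R : realType.
Local Notation C := (Cx R).
Implicit Types (x y z : C) (r e : R).

(** The norm of [Cx R] takes its values in [Cx R] itself; through this equation estimates move to
    [R], where [lra] and [nra] apply. *)
Lemma cabsE z : `|z| = ((cabs z)%:C)%C.
Proof. by []. Qed.

Lemma cabsM x y : cabs (x * y) = cabs x * cabs y.
Proof. exact: ComplexField.Normc.normcM. Qed.

Lemma cabs0 : cabs (0 : C) = 0.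
Proof. exact: ComplexField.Normc.normc0. Qed.

Lemma cabs1 : cabs (1 : C) = 1.
Proof. exact: ComplexField.Normc.normc1. Qed.

Lemma cabs_eq0 z : cabs z = 0 -> z = 0.
Proof. exact: ComplexField.Normc.eq0_normc. Qed.

Lemma cabs_gt0 z : z != 0 -> 0 < cabs z.
Proof.
move=> z0; rewrite lt0r cabs_ge0 andbT; apply: contra z0 => /eqP/cabs_eq0 ->.
by [].
Qed.

Lemma cabsX z n : cabs (z ^+ n) = cabs z ^+ n.
Proof. by elim: n => [|n IH]; rewrite ?expr0 ?cabs1// !exprS cabsM IH. Qed.

Lemma ler_cabsD x y : cabs (x + y) <= cabs x + cabs y.
Proof. by have := ler_normD x y; rewrite !cabsE -rmorphD lecR. Qed.

Lemma cabsN x : cabs (- x) = cabs x.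
Proof. by have := normrN x; rewrite !cabsE => /complexI. Qed.

Lemma cabsV x : cabs x^-1 = (cabs x)^-1.
Proof. exact: ComplexField.Normc.normcV. Qed.

Lemma ler_cabsB x y : cabs (x - y) <= cabs x + cabs y.
Proof. by rewrite -(cabsN y) ler_cabsD. Qed.

Lemma cabs_sub x y : cabs (x - y) = cabs (y - x).
Proof. by rewrite -cabsN opprB. Qed.

Lemma cabs_nat n : cabs (n%:R : C) = n%:R.
Proof.
have := normr_nat C n; rewrite cabsE => /(congr1 (@complex.Re R)) /= ->.
by rewrite -(rmorph_nat (real_complex R)).
Qed.

Lemma cabs_conj z : cabs (z^*) = cabs z.
Proof. by case: z => a b; rewrite /cabs /= sqrrN. Qed.

Lemma cabs_real r : cabs ((r%:C)%C : C) = `|r|.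
Proof. by rewrite /cabs /= expr0n addr0 sqrtr_sqr. Qed.

Lemma sqr_cabs z : cabs z ^+ 2 = complex.Re z ^+ 2 + complex.Im z ^+ 2.
Proof.
by case: z => a b; rewrite /cabs /= sqr_sqrtr // addr_ge0 ?sqr_ge0.
Qed.

Lemma sqr_cabsE z : ((cabs z ^+ 2)%:C)%C = z * z^*.
Proof. by case: z => a b; rewrite sqr_cabs /=; congr (_ +i* _)%C; ring. Qed.

Lemma ler_Re_cabs z : `|complex.Re z| <= cabs z.
Proof.
rewrite -(@ler_pXn2r _ 2) ?nnegrE//= real_normK ?num_real//.
by rewrite sqr_cabs lerDl sqr_ge0.
Qed.

Lemma ler_Im_cabs z : `|complex.Im z| <= cabs z.
Proof.
rewrite -(@ler_pXn2r _ 2) ?nnegrE//= real_normK ?num_real//.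
by rewrite sqr_cabs lerDr sqr_ge0.
Qed.

Lemma ReD x y : complex.Re (x + y) = complex.Re x + complex.Re y.
Proof. by case: x; case: y. Qed.

Lemma ImD x y : complex.Im (x + y) = complex.Im x + complex.Im y.
Proof. by case: x; case: y. Qed.

Lemma ReN x : complex.Re (- x) = - complex.Re x.
Proof. by case: x. Qed.

Lemma ImN x : complex.Im (- x) = - complex.Im x.
Proof. by case: x. Qed.

Lemma cReM x y : complex.Re (x * y) =
  complex.Re x * complex.Re y - complex.Im x * complex.Im y.
Proof. by case: x; case: y. Qed.

Lemma cImM x y : complex.Im (x * y) =
  complex.Re x * complex.Im y + complex.Im x * complex.Re y.
Proof. by case: x => a b; case: y => c d /=; rewrite (mulrC b). Qed.

Lemma cRe_conj x : complex.Re (x^*) = complex.Re x.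
Proof. by case: x. Qed.

Lemma cIm_conj x : complex.Im (x^*) = - complex.Im x.
Proof. by case: x. Qed.

Lemma ler_cabs_ReIm z : cabs z <= `|complex.Re z| + `|complex.Im z|.
Proof.
rewrite -(@ler_pXn2r _ 2) ?nnegrE ?addr_ge0//= sqr_cabs sqrrD.
rewrite !real_normK ?num_real// addrAC lerDl.
by rewrite mulrn_wge0// mulr_ge0.
Qed.

Lemma ler_cabs_sum (I : Type) (s : seq I) (P : pred I) (F : I -> C) :
  cabs (\sum_(i <- s | P i) F i) <= \sum_(i <- s | P i) cabs (F i).
Proof.
elim/big_ind2 : _ => //; first by rewrite cabs0.
by move=> a b c d h1 h2; apply: le_trans (ler_cabsD _ _) _; apply: lerD.
Qed.

Lemma ler_sub_cabs x y : cabs x - cabs y <= cabs (x - y).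
Proof. by rewrite lerBlDr -{1}(subrK y x) ler_cabsD. Qed.

Lemma diskE z : disk R z <-> cabs z < 1.
Proof. by rewrite /disk /= cabsE -[1]/((1%:C)%C) ltcR. Qed.

(** In the order of [Cx R] a positive element is real, so the epsilons of its topology can be taken
    in [R]. *)
Lemma gtC0P (e : C) : 0 < e -> exists2 r : R, 0 < r & e = (r%:C)%C.
Proof.
case: e => a b; rewrite ltcE /= => /andP[/eqP -> a0]; by exists a.
Qed.

Lemma cvgCP {T : Type} {F : set_system T} {FF : Filter F} (f : T -> C) (l : C) :
  f x @[x --> F] --> l <-> forall e : R, 0 < e ->
    \forall x \near F, cabs (l - f x) < e.
Proof.
split.
  move=> /cvgrPdist_lt h e e0; have e0' : 0 < (e%:C)%C by rewrite ltcR.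
  by have := h _ e0'; apply: filterS => x; rewrite cabsE ltcR.
move=> h; apply/cvgrPdist_lt => _ /gtC0P [r r0 ->].
by have := h _ r0; apply: filterS => x; rewrite cabsE ltcR.
Qed.

(** The complex derivative as a first-order expansion: no division by the increment, and the same
    shape as the expansions in conj z and in two real variables used below. *)
Definition cdiff (u : C -> C) (z A : C) := forall e : R, 0 < e ->
  exists2 d : R, 0 < d & forall w, cabs w < d ->
    cabs (u (w + z) - u z - A * w) <= e * cabs w.

Lemma cdiffP (u : C -> C) z A : cdiff u z A <-> is_derive z 1 u A.
Proof.
have Q : (fun h : C => h^-1 *: ((u \o shift z) (h *: (1 : C)) - u z)) =
           (fun h : C => h^-1 *: (u (h + z) - u z)).
  by apply/funext => h /=; rewrite [h *: 1]mulr1.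
have E : is_derive z 1 u A <->
    ((fun h : C => h^-1 *: (u (h + z) - u z)) h @[h --> 0^'] --> A).
  split.
    by move=> [du <-]; move: du; rewrite /derivable /derive Q.
  move=> h; apply: DeriveDef; first by rewrite /derivable Q; apply/cvg_ex;
    exists A.
  by rewrite /derive Q; apply: cvg_lim h.
rewrite E cvgCP; split.
  move=> h e e0.
  (* The expansion gives a non-strict bound and the limit asks for a strict one, hence the half. *)
  have e20 : 0 < e / 2 by lra.
  have [d d0 hd] := h _ e20.
  apply/nbhs_ballP; exists ((d%:C)%C); first by rewrite /= ltcR.
  move=> w; rewrite -ball_normE /= sub0r normrN cabsE ltcR => wd w0.
  have := hd w wd.
  have cw := cabs_gt0 w0.
  rewrite [_ *: _](_ : _ = A + w^-1 * (u (w + z) - u z - A * w)); last first.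
    by rewrite /GRing.scale /= [RHS](_ : _ = w^-1 * (u (w + z) - u z) +
      A * (1 - w^-1 * w));
      [rewrite mulVf // subrr mulr0 addr0|ring].
  rewrite opprD addrA subrr sub0r cabsN cabsM cabsV => H.
  rewrite mulrC ltr_pdivrMr //; apply: le_lt_trans H _.
  by rewrite ltr_pM2r//; lra.
move=> h e e0; have := h _ e0 => /nbhs_ballP [_ /= /gtC0P [d d0 ->] hd].
exists d => // w wd; have [->|w0] := eqVneq w 0.
  by rewrite add0r subrr mulr0 subr0 cabs0 mulr0.
have := hd w; rewrite -ball_normE /= sub0r normrN cabsE ltcR => /(_ wd w0).
have cw := cabs_gt0 w0.
rewrite [_ *: _](_ : _ = A + w^-1 * (u (w + z) - u z - A * w)); last first.
  by rewrite /GRing.scale /= [RHS](_ : _ = w^-1 * (u (w + z) - u z) +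
    A * (1 - w^-1 * w));
      [rewrite mulVf // subrr mulr0 addr0|ring].
rewrite opprD addrA subrr sub0r cabsN cabsM cabsV mulrC ltr_pdivrMr //.
exact: ltW.
Qed.

End Modulus.

(** * Power series on the unit disk *)

Section PowerSeries.
Variable R : realType.
Local Notation C := (Cx R).
Implicit Types (a b : nat -> C) (z w : C) (u v : C -> C).

Lemma lerXn (x y : R) k : 0 <= x -> x <= y -> x ^+ k <= y ^+ k.
Proof.
by move=> x0 xy; apply: lerXn2r; rewrite ?nnegrE //; apply: le_trans xy.
Qed.

Definition psum a n z : C := \sum_(k < n) a k * z ^+ k.

Lemma psumS a n z : psum a n.+1 z = psum a n z + a n * z ^+ n.
Proof. by rewrite /psum big_ord_recr. Qed.

Lemma power_seriesP a u : power_series a u <->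
  forall z, cabs z < 1 -> forall e : R, 0 < e ->
    exists N, forall n, (N <= n)%N -> cabs (u z - psum a n z) < e.
Proof.
have E z : series (fun k => a k * z ^+ k) = (fun n => psum a n z).
  by rewrite seriesEord.
split=> h z /diskE zd.
  move=> e e0; have := h z zd; rewrite E => /cvgCP /(_ _ e0) [N _ hN].
  by exists N => n Nn; apply: hN.
rewrite E; apply/cvgCP => e e0; have [N hN] := h z zd e e0.
by exists N => // n /= Nn; apply: hN.
Qed.

(* The radius of convergence of the power series is at least 1. *)
Definition subexp a := forall r : R, 0 <= r < 1 ->
  exists M : R, forall k, cabs (a k) * r ^+ k <= M.

(** A bound at one radius serves all smaller ones, so only radii close to 1 matter; these are also
    positive, which allows dividing by their powers. The maximum with 1/2 secures positivity. *)
Lemma subexp_near1 a (r0 : R) : r0 < 1 ->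
  (forall r, 0 < r -> r0 <= r < 1 ->
    exists M, forall k, cabs (a k) * r ^+ k <= M) ->
  subexp a.
Proof.
move=> r01 h r /andP[rge0 r1].
have [M hM] : exists M, forall k,
  cabs (a k) * (Num.max (Num.max r r0) 2^-1) ^+ k <= M.
  apply: h; first by rewrite lt_max; apply/orP; right; rewrite invr_gt0.
  rewrite !le_max lexx orbT/= !gt_max r1 r01/= invf_lt1//; lra.
exists M => k; apply: le_trans (hM k); apply: ler_wpM2l => //.
by apply: lerXn => //; rewrite !le_max lexx.
Qed.

Lemma le_subexp a b : (forall k, cabs (b k) <= cabs (a k)) -> subexp a ->
  subexp b.
Proof.
move=> h ha r r01; have [M hM] := ha r r01; exists M => k.
apply: le_trans (hM k); apply: ler_wpM2r => //.
by case/andP: r01 => r0 _; apply: exprn_ge0.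
Qed.

(** Beyond some rank a term is the difference of two partial sums within 1 of the limit, hence at
    most 2; the finite sum in the bound takes care of the earlier terms. *)
Lemma power_series_subexp a u : power_series a u -> subexp a.
Proof.
move=> /power_seriesP h r /andP[r0 r1].
have cr : cabs ((r%:C)%C : C) = r by rewrite cabs_real ger0_norm.
have [N hN] := h ((r%:C)%C) (eq_ind_r (fun x => x < 1) r1 cr) 1 ltr01.
have hb k : (N <= k)%N -> cabs (a k) * r ^+ k <= 2.
  move=> Nk; rewrite -{1}cr -cabsX -cabsM.
  set z : C := (r%:C)%C.
  have -> : a k * z ^+ k = (u z - psum a k z) - (u z - psum a k.+1 z).
    by rewrite psumS; ring.
  apply: le_trans (ler_cabsB _ _) _.
  by have := hN k Nk; have := hN k.+1 (leqW Nk); lra.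
exists (2 + \sum_(k < N) cabs (a k) * r ^+ k) => k.
have S0 : 0 <= \sum_(k < N) cabs (a k) * r ^+ k.
  by apply: sumr_ge0 => i _; rewrite mulr_ge0// exprn_ge0.
have [Nk|kN] := leqP N k; first by have := hb _ Nk; lra.
rewrite (bigD1 (Ordinal kN)) //=.
have : 0 <= \sum_(i < N | i != Ordinal kN) cabs (a i) * r ^+ i.
  by apply: sumr_ge0 => i _; rewrite mulr_ge0// exprn_ge0.
lra.
Qed.

Lemma geo_sum_le (t : R) n : 0 <= t < 1 -> \sum_(k < n) t ^+ k <= (1 - t)^-1.
Proof.
move=> /andP[t0 t1]; have t1' : 0 < 1 - t by lra.
rewrite -[leRHS]mul1r ler_pdivlMr// mulrC.
have := subrX1 t n; have : 0 <= t ^+ n by apply: exprn_ge0.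
nra.
Qed.

(** Abel's comparison: with r < q < 1, boundedness at radius q dominates the terms at radius r by a
    geometric sequence of ratio r / q. *)
Lemma subexp_sum a (r : R) : subexp a -> 0 <= r < 1 ->
  exists2 M : R, 0 <= M & forall n, \sum_(k < n) cabs (a k) * r ^+ k <= M.
Proof.
move=> ha /andP[r0 r1]; pose q := (1 + r) / 2.
have q0 : 0 < q by rewrite /q; lra.
have q1 : q < 1 by rewrite /q; lra.
have rq : r < q by rewrite /q; lra.
have [M hM] := ha q (introT andP (conj (ltW q0) q1)).
have M0 : 0 <= M by apply: le_trans (hM 0); rewrite expr0 mulr1.
have t01 : 0 <= r / q < 1 by rewrite divr_ge0 ?(ltW q0)//= ltr_pdivrMr// mul1r.
exists (M * (1 - r / q)^-1) => [|n].
  by rewrite mulr_ge0// invr_ge0; case/andP: t01 => _; lra.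
apply: le_trans (_ : _ <= \sum_(k < n) M * (r / q) ^+ k) _; last first.
  by rewrite -mulr_sumr ler_wpM2l// geo_sum_le.
apply: ler_sum => k _; have -> : r ^+ k = q ^+ k * (r / q) ^+ k.
  by rewrite -exprMn mulrC divfK// gt_eqF.
rewrite mulrA ler_wpM2r// exprn_ge0//; by case/andP: t01.
Qed.

Lemma subexp_mulk a : subexp a -> subexp (fun k => k.+1%:R * a k).
Proof.
move=> ha r /andP[r0 r1]; pose q := (1 + r) / 2.
have q0 : 0 < q by rewrite /q; lra.
have q1 : q < 1 by rewrite /q; lra.
have rq : r < q by rewrite /q; lra.
have [M hM] := ha q (introT andP (conj (ltW q0) q1)).
have M0 : 0 <= M by apply: le_trans (hM 0); rewrite expr0 mulr1.
have t01 : 0 <= r / q < 1 by rewrite divr_ge0 ?(ltW q0)//= ltr_pdivrMr// mul1r.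
(* For t = r / q < 1 the powers decrease, so (k+1) t^k <= 1 + t + ... + t^k. The slightly larger
   radius q thus absorbs the factor k + 1. *)
have tk k : k.+1%:R * (r / q) ^+ k <= (1 - r / q)^-1.
  apply: le_trans (geo_sum_le k.+1 t01).
  have -> : k.+1%:R * (r / q) ^+ k = \sum_(i < k.+1) (r / q) ^+ k.
    by rewrite big_const_ord iter_addr_0 mulr_natl.
  apply: ler_sum => i _; case/andP: t01 => t0 t1.
  by apply: ler_wiXn2l => //; [exact: ltW | rewrite -ltnS].
exists (M * (1 - r / q)^-1) => k; rewrite cabsM cabs_nat.
have -> : r ^+ k = q ^+ k * (r / q) ^+ k.
  by rewrite -exprMn mulrC divfK// gt_eqF.
rewrite [leLHS](_ : _ = (cabs (a k) * q ^+ k) * (k.+1%:R * (r / q) ^+ k));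
  last by ring.
apply: ler_pM => //; rewrite mulr_ge0// exprn_ge0//; first exact: ltW.
by case/andP: t01.
Qed.

Lemma subexp_shift m a : subexp a -> subexp (fun k => a (m + k)%N).
Proof.
move=> ha; apply: (@subexp_near1 _ 0) => // r r0 /andP[_ r1].
have [M hM] := ha r (introT andP (conj (ltW r0) r1)).
exists (M / r ^+ m) => k; rewrite ler_pdivlMr ?exprn_gt0//.
by rewrite -mulrA -exprD addnC; exact: hM.
Qed.

Lemma subexpS a : subexp a -> subexp (fun k => a k.+1).
Proof. exact: (@subexp_shift 1). Qed.

Lemma subexp_sums a z : subexp a -> cabs z < 1 ->
  exists2 M : R, 0 <= M & forall n, \sum_(k < n) cabs (a k * z ^+ k) <= M.
Proof.
move=> ha z1; have [M M0 hM] := @subexp_sum a (cabs z) ha (introT andP (conj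
  (cabs_ge0 z) z1)).
exists M => // n; apply: le_trans (hM n).
by apply: ler_sum => i _; rewrite cabsM cabsX.
Qed.

Lemma bounded_series_cvg (x : nat -> R) (M : R) :
  (forall n, \sum_(k < n) `|x k| <= M) -> cvgn (series x).
Proof.
move=> h; apply: normed_cvg; apply: nondecreasing_is_cvgn.
  apply/nondecreasing_seqP => n; by rewrite /= seriesSr lerDl.
exists M. apply/ubP => _ [n _ <-]. rewrite /= seriesEord. exact: h.
Qed.

(** Absolute convergence gives the real and imaginary parts of the sum separately. Outside the disk
    the value is 0 by default. *)
Lemma subexp_power_series a : subexp a -> exists u, power_series a u.
Proof.
move=> ha.
have H z : exists l : C, cabs z < 1 -> forall e : R, 0 < e ->
    exists N, forall n, (N <= n)%N -> cabs (l - psum a n z) < e.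
  have [z1|z1] := ltP (cabs z) 1; last by exists 0.
  have [M M0 hM] := subexp_sums ha z1.
  have c1 : cvgn (series (fun k => complex.Re (a k * z ^+ k))).
    apply: (@bounded_series_cvg _ M) => n; apply: le_trans (hM n).
    by apply: ler_sum => i _; apply: ler_Re_cabs.
  have c2 : cvgn (series (fun k => complex.Im (a k * z ^+ k))).
    apply: (@bounded_series_cvg _ M) => n; apply: le_trans (hM n).
    by apply: ler_sum => i _; apply: ler_Im_cabs.
  have s1 n : series (fun k => complex.Re (a k * z ^+ k)) n = complex.Re (psum a
    n z).
    rewrite seriesEord /psum /=; elim/big_rec2 : _ => //= i x y _ ->.
    by rewrite ReD.
  have s2 n : series (fun k => complex.Im (a k * z ^+ k)) n = complex.Im (psum a
    n z).
    rewrite seriesEord /psum /=; elim/big_rec2 : _ => //= i x y _ ->.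
    by rewrite ImD.
  exists ((limn (series (fun k => complex.Re (a k * z ^+ k)))) +i*
          (limn (series (fun k => complex.Im (a k * z ^+ k)))))%C.
  move=> _ e e0; have e20 : 0 < e / 2 by lra.
  move: c1 => /cvgrPdist_lt /(_ _ e20) [N1 _ h1].
  move: c2 => /cvgrPdist_lt /(_ _ e20) [N2 _ h2].
  exists (maxn N1 N2) => n; rewrite geq_max => /andP[n1 n2].
  have {h1} := h1 n n1; have {h2} := h2 n n2; rewrite s1 s2 => h2 h1.
  apply: le_lt_trans (ler_cabs_ReIm _) _.
  by rewrite ReD ImD ReN ImN /=; lra.
have [u hu] := choice H; exists u; apply/power_seriesP => z z1.
exact: hu.
Qed.

Lemma power_series_bound a u z (s : C) (M : R) N : power_series a u ->
  cabs z < 1 ->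
  (forall n, (N <= n)%N -> cabs (s - psum a n z) <= M) -> cabs (s - u z) <= M.
Proof.
move=> /power_seriesP h z1 hM; apply/ler_addgt0Pr => e e0.
have [N' hN] := h z z1 e e0.
have := hN (maxn N N') (leq_maxr _ _); have := hM (maxn N N') (leq_maxl _ _).
have -> : s - u z = (s - psum a (maxn N N') z) - (u z - psum a (maxn N N') z) by
  ring.
by have := ler_cabsB (s - psum a (maxn N N') z) (u z - psum a (maxn N N') z);
  lra.
Qed.

Lemma eq_power_series a u v : (forall z, disk R z -> u z = v z) ->
  power_series a u -> power_series a v.
Proof. by move=> uv h z zd; rewrite -uv//; exact: h. Qed.

Lemma power_seriesD a b u v : power_series a u -> power_series b v ->
  power_series (fun k => a k + b k) (fun z => u z + v z).
Proof.
move=> hu hv z zd; rewrite [X in X @ _](_ : _ =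
   (fun n => series (fun k => a k * z ^+ k) n + series (fun k =>
     b k * z ^+ k) n)).
  by apply: cvgD; [exact: hu|exact: hv].
apply/funext => n; rewrite !seriesEord /= -big_split; apply: eq_bigr => i _.
by rewrite mulrDl.
Qed.

Lemma power_seriesZ (c : C) a u : power_series a u ->
  power_series (fun k => c * a k) (fun z => c * u z).
Proof.
move=> hu z zd; rewrite [X in X @ _](_ : _ =
   (fun n => c * series (fun k => a k * z ^+ k) n)).
  by apply: cvgM; [exact: cvg_cst|exact: hu].
apply/funext => n; rewrite !seriesEord /= mulr_sumr; apply: eq_bigr => i _.
by rewrite mulrA.
Qed.

Lemma power_seriesX a u : power_series a u ->
  power_series (fun k => if k is j.+1 then a j else 0) (fun z => z * u z).
Proof.
move=> /power_seriesP hu; apply/power_seriesP => z zd e e0.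
have [N hN] := hu z zd e e0; exists N.+1 => -[//|n] Nn.
have -> : psum (fun k => if k is j.+1 then a j else 0) n.+1 z = z * psum a n z.
  rewrite /psum big_ord_recl /= mul0r add0r mulr_sumr; apply: eq_bigr => i _.
  by rewrite /bump /= add1n exprS; ring.
rewrite -mulrBr cabsM; apply: le_lt_trans (hN n Nn).
by rewrite ler_piMl// ltW.
Qed.

Lemma power_seriesXn m a u : power_series a u ->
  power_series (fun k => if (m <= k)%N then a (k - m)%N else 0) (fun z =>
    z ^+ m * u z).
Proof.
move=> hu; elim: m => [|m /power_seriesX].
  rewrite [X in power_series X](_ : _ = a); last first.
    by apply/funext => k; rewrite leq0n subn0.
  by apply: eq_power_series hu => z _; rewrite expr0 mul1r.
rewrite [X in power_series X](_ : _ =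
   (fun k => if (m < k)%N then a (k - m.+1)%N else 0)); last first.
  by apply/funext => -[|k].
by apply: eq_power_series => z _; rewrite exprS mulrA.
Qed.

Lemma power_series_poly m a :
  power_series (fun k => if (k < m)%N then a k else 0) (fun z =>
    \sum_(k < m) a k * z ^+ k).
Proof.
apply/power_seriesP => z zd e e0; exists m => n mn.
rewrite /psum (big_ord_widen n (fun k => a k * z ^+ k) mn) big_mkcond.
rewrite (eq_bigr (fun k : 'I_n => (if (k < m)%N then a k else 0) * z ^+ k)).
  by rewrite subrr cabs0.
by move=> i _; case: ifP => //; rewrite mul0r.
Qed.

(** Second-order Taylor remainder of a monomial. The constant is that of its second derivative, so
    that summing over k produces the series of [dcoef (dcoef a)]. *)
Lemma mono_taylor2 (z w : C) (r : R) k : cabs z + cabs w <= r ->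
  cabs ((w + z) ^+ k.+2 - z ^+ k.+2 - k.+2%:R * z ^+ k.+1 * w) <=
    k.+2%:R * k.+1%:R * r ^+ k * cabs w ^+ 2.
Proof.
move=> zwr.
have r0 : 0 <= r by apply: le_trans zwr; apply: addr_ge0.
have wz : cabs (w + z) <= r by apply: le_trans (ler_cabsD _ _) _; rewrite addrC.
have zr : cabs z <= r by apply: le_trans zwr; rewrite lerDl.
elim: k => [|k IH].
  have -> : (w + z) ^+ 2 - z ^+ 2 - 2%:R * z ^+ 1 * w = w ^+ 2 by ring.
  by rewrite cabsX expr0 mulr1 mulr1 ler_peMl ?sqr_ge0// ler1n.
(* The remainder of degree k+3 is (w + z) times that of degree k+2, plus (k+2) w^2 z^(k+1); the
   constants add up as (k+2)(k+1) + (k+2) = (k+2)^2. *)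
have -> : (w + z) ^+ k.+3 - z ^+ k.+3 - k.+3%:R * z ^+ k.+2 * w =
  (w + z) * ((w + z) ^+ k.+2 - z ^+ k.+2 - k.+2%:R * z ^+ k.+1 * w) +
  k.+2%:R * (w ^+ 2 * z ^+ k.+1).
  by rewrite -[k.+3%:R]natr1 !exprS; move: (_ ^+ k) (z ^+ k) => X Y; ring.
apply: le_trans (ler_cabsD _ _) _; rewrite !cabsM cabs_nat !cabsX.
have h1 : cabs (w + z) * cabs ((w +
  z) ^+ k.+2 - z ^+ k.+2 - k.+2%:R * z ^+ k.+1 * w)
   <= r * (k.+2%:R * k.+1%:R * r ^+ k * cabs w ^+ 2) by apply: ler_pM.
have h2 : k.+2%:R * (cabs w ^+ 2 * cabs z ^+ k.+1) <=
  k.+2%:R * (cabs w ^+ 2 * r ^+ k.+1).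
  apply: ler_wpM2l => //; apply: ler_wpM2l; first exact: sqr_ge0.
  by apply: lerXn.
apply: le_trans (lerD h1 h2) _.
have -> : r * (k.+2%:R * k.+1%:R * r ^+ k * cabs w ^+ 2) +
  k.+2%:R * (cabs w ^+ 2 * r ^+ k.+1)
  = k.+2%:R * k.+2%:R * r ^+ k.+1 * cabs w ^+ 2.
  by rewrite -[k.+2%:R]natr1 [r ^+ k.+1]exprS; ring.
rewrite ler_wpM2r ?sqr_ge0// ler_wpM2r ?exprn_ge0// ler_wpM2r//.
by rewrite ler_nat.
Qed.

Definition dcoef a k := k.+1%:R * a k.+1.

Lemma subexp_dcoef a : subexp a -> subexp (dcoef a).
Proof.
move=> /subexpS ha; exact: subexp_mulk.
Qed.

(** Summing the quadratic remainders of the monomials bounds the remainder of every partial sum by M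
    |w|^2, where M sums the second derived series at a radius r strictly between |z| and 1. The
    bound passes to the limit. *)
Lemma power_series_cdiff a u v : power_series a u -> power_series (dcoef a) v ->
  forall z, disk R z -> cdiff u z (v z).
Proof.
move=> hu hv z /diskE z1.
have ha := power_series_subexp hu.
pose r := (1 + cabs z) / 2.
have r0 : 0 < r by rewrite /r; have := cabs_ge0 z; lra.
have r1 : r < 1 by rewrite /r; lra.
have zr : cabs z < r by rewrite /r; lra.
have [M M0 hM] := @subexp_sum _ r (subexp_dcoef (subexp_dcoef ha)) (introT andP
  (conj (ltW r0) r1)).
have key w : cabs w <= r - cabs z ->
   cabs (u (w + z) - u z - v z * w) <= M * cabs w ^+ 2.
  move=> wr; have wz1 : cabs (w + z) < 1.
    by apply: le_lt_trans (ler_cabsD _ _) _; lra.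
  have zwr : cabs z + cabs w <= r by lra.
  have part n : cabs (psum a n.+2 (w +
    z) - psum a n.+2 z - psum (dcoef a) n.+1 z * w) <=
     M * cabs w ^+ 2.
    have -> : psum a n.+2 (w + z) - psum a n.+2 z - psum (dcoef a) n.+1 z * w =
      \sum_(k < n) a k.+2 * ((w + z) ^+ k.+2 - z ^+ k.+2 - k.+2%:R * z ^+ k.+1 *
        w).
      have H x : psum a n.+2 x = a 0 + (a 1 * x +
        \sum_(k < n) a k.+2 * x ^+ k.+2).
        by rewrite /psum !big_ord_recl /= !expr1 expr0 mulr1.
      have H' : psum (dcoef a) n.+1 z = a 1 +
        \sum_(k < n) k.+2%:R * a k.+2 * z ^+ k.+1.
        by rewrite /psum big_ord_recl /= expr0 mulr1 /dcoef mul1r.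
      rewrite !H H' [RHS](_ : _ = \sum_(k < n) a k.+2 * (w + z) ^+ k.+2 -
         \sum_(k < n) a k.+2 * z ^+ k.+2 - (\sum_(k < n) k.+2%:R * a k.+2 * z ^+
           k.+1) * w).
        by ring.
      by rewrite mulr_suml -!sumrB; apply: eq_bigr => i _; ring.
    apply: le_trans (ler_cabs_sum _ _ _) _.
    apply: le_trans (_ : _ <= \sum_(k < n) cabs (dcoef (dcoef a) k) * r ^+ k *
      cabs w ^+ 2) _.
      apply: ler_sum => k _; rewrite cabsM.
      apply: le_trans (ler_wpM2l _ (mono_taylor2 _ zwr)) _ => //.
      rewrite /dcoef !cabsM !cabs_nat le_eqVlt; apply/orP; left; apply/eqP;
        ring.
    by rewrite -mulr_suml ler_wpM2r ?sqr_ge0.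
  apply/ler_addgt0Pr => e e0; have e3 : 0 < e / 3 by lra.
  move: hu hv => /power_seriesP hu /power_seriesP hv.
  have [N1 h1] := hu _ wz1 _ e3; have [N2 h2] := hu _ z1 _ e3.
  have [N3 h3] := hv _ z1 _ e3.
  pose n := (N1 + N2 + N3)%N; have := part n.
  have [n1 n2] : (N1 <= n)%N /\ (N2 <= n)%N.
    by rewrite /n -addnA leq_addr addnCA leq_addr.
  have {h1} := h1 n.+2 (leqW (leqW n1)).
  have {h2} := h2 n.+2 (leqW (leqW n2)).
  have {h3} := h3 n.+1 (leqW (leq_addl _ _)).
  set p1 := psum _ _ _; set p2 := psum _ _ _;
    set p3 := psum _ _ _ => h3 h2 h1 h4.
  have -> : u (w + z) - u z - v z * w =
    (p3 - p2 - p1 * w) + ((u (w + z) - p3) - (u z - p2) - (v z - p1) * w) by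
      ring.
  apply: le_trans (ler_cabsD _ _) _; apply: lerD => //.
  apply: le_trans (ler_cabsB _ _) _; rewrite cabsM.
  have h5 := ler_cabsB (u (w + z) - p3) (u z - p2).
  have w1 : cabs w <= 1 by have := cabs_ge0 z; lra.
  have h6 : cabs (v z - p1) * cabs w <= e / 3.
    by apply: le_trans (ltW h3); exact: ler_piMr.
  by apply: le_trans (lerD h5 h6) _; lra.
(* The first entry keeps w + z within radius r, the second turns M |w|^2 into e |w|; [M + 1] is
   there because M may be 0. *)
move=> e e0; pose d := Num.min (r - cabs z) (e / (M + 1)).
have M1 : 0 < M + 1 by lra.
exists d; first by rewrite /d lt_min subr_gt0 zr/= divr_gt0.
move=> w; rewrite /d lt_min => /andP[w1 w2].
apply: le_trans (key w (ltW w1)) _.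
rewrite expr2 mulrA ler_wpM2r//.
move: w2; rewrite ltr_pdivlMr// => w2; have := cabs_ge0 w; nra.
Qed.

Lemma power_series_analytic a u : power_series a u -> analytic u.
Proof.
move=> hu; have [v hv] := subexp_power_series (subexp_dcoef (power_series_subexp
  hu)).
by move=> z zd; have /cdiffP[] := power_series_cdiff hu hv zd.
Qed.

Lemma power_series_derive1 a u : power_series a u ->
  power_series (dcoef a) (derive1 u).
Proof.
move=> hu; have [v hv] := subexp_power_series (subexp_dcoef (power_series_subexp
  hu)).
apply: eq_power_series (hv) => z zd.
by have /cdiffP[_ <-] := power_series_cdiff hu hv zd; rewrite derive1E.
Qed.

Lemma disk0 : disk R 0.
Proof. by apply/diskE; rewrite cabs0. Qed.

Lemma power_series_at0 a u : power_series a u -> u 0 = a 0%N.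
Proof.
move=> /power_seriesP hu; apply/eqP; rewrite -subr_eq0; apply/eqP/cabs_eq0.
apply/eqP; rewrite eq_le cabs_ge0 andbT; apply/ler_addgt0Pr => e e0;
  rewrite add0r.
have [N hN] := hu 0 ltac:(by rewrite cabs0) e e0.
have := hN N.+1 (leqnSn _); rewrite /psum big_ord_recl expr0 mulr1 big1 ?addr0.
  exact: ltW.
by move=> i _; rewrite lift0 expr0n mulr0.
Qed.

(** The constant coefficient is the value at 0. The others are reached by differentiating, since the
    derived series represents the zero function too. *)
Lemma power_series_eq0 a u : power_series a u -> (forall z, disk R z ->
  u z = 0) ->
  forall k, a k = 0.
Proof.
move=> hu u0 k; elim: k a u hu u0 => [|k IH] a u hu u0.
  by rewrite -(power_series_at0 hu) u0//; exact: disk0.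
have hv : power_series (dcoef a) (fun=> 0).
  have [v hv] := subexp_power_series (subexp_dcoef (power_series_subexp hu)).
  have u0' : power_series a (fun=> 0) by exact: eq_power_series hu.
  apply: eq_power_series (hv) => z zd.
  have /cdiffP[_ <-] := power_series_cdiff u0' hv zd.
  by have [] := is_derive_cst (0 : C) z 1.
have := IH _ _ hv (fun _ _ => erefl) => /eqP.
by rewrite /dcoef mulf_eq0 pnatr_eq0 => /eqP.
Qed.

Lemma power_series_inj a b u v : power_series a u -> power_series b v ->
  (forall z, disk R z -> u z = v z) -> forall k, a k = b k.
Proof.
move=> hu hv uv k; apply/eqP; rewrite -subr_eq0; apply/eqP.
have hd := power_seriesD hu (power_seriesZ (c := -1) hv).
have := power_series_eq0 hd; rewrite /= => /(_ _ k) <-; first by rewrite mulN1r.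
by move=> z zd; rewrite uv// mulN1r subrr.
Qed.

Lemma power_series_uniq a u v : power_series a u -> power_series a v ->
  forall z, disk R z -> u z = v z.
Proof.
by move=> hu hv z zd; apply: cvg_unique (hu z zd) (hv z zd).
Qed.

Definition cauchy_prod a b k := \sum_(i < k.+1) a (k - i)%N * b i.

Lemma psum_cauchy_prod a b n z :
  psum (cauchy_prod a b) n z = \sum_(i < n) b i * z ^+ i * psum a (n - i) z.
Proof.
elim: n => [|n IH]; first by rewrite /psum !big_ord0.
rewrite psumS IH big_ord_recr /= subSnn.
rewrite [X in _ = X + _](eq_bigr (fun i : 'I_n =>
  b i * z ^+ i * psum a (n - i) z +
   a (n - i)%N * b i * z ^+ n)); last first.
  move=> i _; rewrite subSn ?psumS; last by rewrite ltnW.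
  have -> : z ^+ n = z ^+ i * z ^+ (n - i) by rewrite -exprD subnKC// ltnW.
  by ring.
rewrite big_split /= /cauchy_prod -addrA; congr (_ + _).
rewrite big_ord_recr /= subnn mulrDl mulr_suml; congr (_ + _).
by rewrite /psum big_ord1 expr0 mulr1; ring.
Qed.

(** A geometric rate of convergence, uniform in n; this is what makes the Cauchy product
    converge. *)
Lemma power_series_tail a u z (s : R) : power_series a u -> cabs z < s ->
  s < 1 ->
  exists2 M : R, 0 <= M & forall n,
    cabs (u z - psum a n z) <= M * (cabs z / s) ^+ n.
Proof.
move=> hu zs s1; have s0 : 0 < s by apply: le_lt_trans zs.
have [M M0 hM] := subexp_sum (power_series_subexp hu) (introT andP (conj (ltW
  s0) s1)).
exists M => // n; rewrite cabs_sub.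
apply: (power_series_bound (N := n) hu (lt_trans zs s1)) => p np.
rewrite cabs_sub -(subnKC np); move: (p - n)%N => {np}p.
have -> : psum a (n + p) z - psum a n z = \sum_(k < p) a (n + k)%N * z ^+ (n +
  k).
  by rewrite /psum big_split_ord /= addrAC subrr add0r.
apply: le_trans (ler_cabs_sum _ _ _) _.
have t0 : 0 <= cabs z / s by rewrite divr_ge0// ltW.
have t1 : cabs z / s <= 1 by rewrite ler_pdivrMr// mul1r ltW.
apply: le_trans (_ : _ <= \sum_(k < p) cabs (a (n + k)%N) * s ^+ (n +
  k) * (cabs z / s) ^+ n) _.
  apply: ler_sum => k _; rewrite cabsM cabsX -mulrA ler_wpM2l//.
  have -> : cabs z ^+ (n + k) = s ^+ (n + k) * (cabs z / s) ^+ (n + k).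
    by rewrite -exprMn mulrC divfK// gt_eqF.
  rewrite ler_wpM2l ?exprn_ge0 ?(ltW s0)//.
  by apply: ler_wiXn2l => //; rewrite leq_addr.
rewrite -mulr_suml ler_wpM2r ?exprn_ge0//.
apply: le_trans (hM (n + p)%N).
rewrite big_split_ord /= lerDr; apply: sumr_ge0 => i _.
by rewrite mulr_ge0// exprn_ge0// ltW.
Qed.

(** The error is u times a tail of v, plus the terms b_i z^i times the tail of u at rank n - i. With
    |z| = s t, such a tail is at most M t^(n-i) and |b_i z^i| = |b_i| s^i t^i, so t^n factors out of
    the whole error. *)
Lemma power_seriesM a b u v : power_series a u -> power_series b v ->
  power_series (cauchy_prod a b) (fun z => u z * v z).
Proof.
move=> hu hv; apply/power_seriesP => z z1 e e0.
pose s := (1 + cabs z) / 2.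
have s1 : s < 1 by rewrite /s; lra.
have zs : cabs z < s by rewrite /s; lra.
have s0 : 0 < s by apply: le_lt_trans zs.
have [M M0 hM] := power_series_tail hu zs s1.
have [K K0 hK] := subexp_sum (power_series_subexp hv) (introT andP (conj (ltW
  s0) s1)).
have [L L0 hL] := power_series_tail hv zs s1.
pose t := cabs z / s.
have t0 : 0 <= t by rewrite divr_ge0// ltW.
have t1 : t < 1 by rewrite ltr_pdivrMr// mul1r.
have step n : cabs (u z * v z - psum (cauchy_prod a b) n z) <=
  (cabs (u z) * L + M * K) * t ^+ n.
  have -> : u z * v z - psum (cauchy_prod a b) n z =
     u z * (v z - psum b n z) + \sum_(i < n) b i * z ^+ i * (u z - psum a (n -
       i) z).
    rewrite psum_cauchy_prod mulrBr /psum mulr_sumr -addrA; congr (_ + _).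
    rewrite -!sumrN -big_split; apply: eq_bigr => i _ /=.
    by rewrite -/(psum a (n - i) z); ring.
  apply: le_trans (ler_cabsD _ _) _; rewrite mulrDl; apply: lerD.
    by rewrite cabsM -mulrA ler_wpM2l.
  apply: le_trans (ler_cabs_sum _ _ _) _.
  apply: le_trans (_ : _ <= \sum_(i < n) (M * t ^+ n) * (cabs (b i) * s ^+ i))
    _.
    apply: ler_sum => i _; rewrite !cabsM cabsX.
    have -> : M * t ^+ n * (cabs (b i) * s ^+ i) =
       cabs (b i) * cabs z ^+ i * (M * t ^+ (n - i)).
      have zst : cabs z = s * t by rewrite /t mulrC divfK// gt_eqF.
      have tn : t ^+ n = t ^+ i * t ^+ (n - i) by rewrite -exprD subnKC// ltnW.
      by rewrite tn zst [(s * t) ^+ _]exprMn; ring.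
    by rewrite ler_wpM2l// mulr_ge0// exprn_ge0.
  by rewrite -mulr_sumr (mulrAC M K) ler_wpM2l// mulr_ge0// exprn_ge0.
have : (cabs (u z) * L + M * K) * t ^+ n @[n --> \oo] --> (0 : R).
  rewrite -[X in _ --> X](mulr0 (cabs (u z) * L + M * K)).
  by apply: cvgMr; apply: cvg_expr; rewrite ger0_norm.
move=> /cvgrPdist_lt /(_ _ e0) [N _ hN]; exists N => n Nn.
apply: le_lt_trans (step n) _; have := hN n Nn.
by rewrite sub0r normrN; apply: le_lt_trans; rewrite ler_norm.
Qed.

End PowerSeries.

(** * Goursat's bisection and the divergence theorem *)

Section Bisection.
Variable R : realType.

(** By subadditivity a positive value on a square persists on one of its four quarters. The nested
    squares so obtained close in on a point (p, q), where the local hypothesis forbids positive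
    values. *)
Lemma bisection (T : R -> R -> R -> R) (x0 y0 L : R) : 0 < L ->
  (forall x y (h : R), 0 < h -> T x y (h + h) <=
     T x y h + T (x + h) y h + T x (y + h) h + T (x + h) (y + h) h) ->
  (forall p q, exists2 d : R, 0 < d & forall x y (h : R), 0 < h < d ->
     x <= p <= x + h -> y <= q <= y + h -> T x y h <= 0) ->
  T x0 y0 L <= 0.
Proof.
move=> L0 hsub hloc; rewrite leNgt; apply/negP => T0.
have st (s : R * R * R) : exists s' : R * R * R, 0 < s.2 ->
  0 < T s.1.1 s.1.2 s.2 ->
   [/\ 0 < T s'.1.1 s'.1.2 s'.2, s'.2 + s'.2 = s.2,
       s.1.1 <= s'.1.1 <= s.1.1 + s'.2 & s.1.2 <= s'.1.2 <= s.1.2 + s'.2].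
  case: s => -[x y] h /=.
  have [h0|] := ltP 0 h; last by move=> h0; exists (x, y, h) => h0'; exfalso;
    lra.
  have [Tp|] := ltP 0 (T x y h); last by move=> Tp; exists (x, y, h) => _ T0';
    exfalso; lra.
  have h2 : 0 < h / 2 by lra.
  have hh : h / 2 + h / 2 = h by lra.
  have := hsub x y _ h2; rewrite hh => H.
  have [p1|n1] := ltP 0 (T x y (h / 2)).
    by exists (x, y, h / 2) => _ _ /=; split => //; lra.
  have [p2|n2] := ltP 0 (T (x + h / 2) y (h / 2)).
    by exists (x + h / 2, y, h / 2) => _ _ /=; split => //; lra.
  have [p3|n3] := ltP 0 (T x (y + h / 2) (h / 2)).
    by exists (x, y + h / 2, h / 2) => _ _ /=; split => //; lra.
  have [p4|n4] := ltP 0 (T (x + h / 2) (y + h / 2) (h / 2)).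
    by exists (x + h / 2, y + h / 2, h / 2) => _ _ /=; split => //; lra.
  by exfalso; lra.
have [nx hnx] := choice st.
pose s n := iter n nx (x0, y0, L).
have inv n : 0 < (s n).2 /\ 0 < T (s n).1.1 (s n).1.2 (s n).2.
  elim: n => [|n [IH1 IH2]] //=.
  by have [h1 h2 _ _] := hnx _ IH1 IH2; split => //; rewrite -/(s n); lra.
have step n := hnx _ (inv n).1 (inv n).2.
have hn n : (s n).2 = L / 2 ^+ n.
  elim: n => [|n IH]; first by rewrite expr0 divr1.
  have [_ h2 _ _] := step n; rewrite IH in h2.
  have -> : s n.+1 = nx (s n) by [].
  apply: (@mulIf _ 2) => //; rewrite exprS invfM mulrA mulrAC.
  by rewrite (mulrAC L) mulfK// -h2; ring.
(* Left ends increase and right ends decrease along the nested squares, so the supremum of the left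
   ends lies in every interval. This serves both coordinates. *)
have lim (c : R * R * R -> R) :
    (forall n, c (s n) <= c (s n.+1) <= c (s n) + (s n.+1).2) ->
    exists p, forall n, c (s n) <= p <= c (s n) + (s n).2.
  move=> hc.
  have mono n k : c (s n) <= c (s (n + k)%N).
    elim: k => [|k IH]; first by rewrite addn0.
    by rewrite addnS; have /andP[+ _] := hc (n + k)%N; apply: le_trans.
  have anti n k : c (s (n + k)%N) + (s (n + k)%N).2 <= c (s n) + (s n).2.
    elim: k => [|k IH]; first by rewrite addn0.
    rewrite addnS; apply: le_trans IH.
    by have /andP[_ h1] := hc (n + k)%N; have [_ h2 _ _] := step (n + k)%N;
      rewrite -h2 -/(s _.+1) /=; move: h1 => /=; lra.
  have ub n m : c (s m) <= c (s n) + (s n).2.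
    apply: le_trans (mono m n) _; rewrite addnC.
    apply: le_trans (anti n m); rewrite lerDl ltW//; exact: (inv _).1.
  have hs : has_sup (range (fun n => c (s n))).
    split; first by exists (c (s 0%N)), 0%N.
    by exists (c (s 0%N) + (s 0%N).2) => _ [m _ <-]; exact: ub.
  exists (sup (range (fun n => c (s n)))) => n; apply/andP; split.
    by apply: sup_ubound; [exact: hs.2 | exists n].
  by apply: ge_sup; [exact: hs.1 | move=> _ [m _ <-]; exact: ub].
have [p hp] := lim (fun s => s.1.1) (fun n => let: And4 _ _ a _ := step n in a).
have [q hq] := lim (fun s => s.1.2) (fun n => let: And4 _ _ _ a := step n in a).
have [d d0 hd] := hloc p q.
have [n hnd] : exists n, (s n).2 < d.
  have : L / 2 ^+ n @[n --> \oo] --> (0 : R).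
    rewrite -[X in _ --> X](mulr0 L); apply: cvgMr.
    rewrite [X in X @ _](_ : _ = (fun n => (2^-1 : R) ^+ n)); last first.
      by apply/funext => n; rewrite exprVn.
    by apply: cvg_expr; rewrite ger0_norm ?invr_ge0// invf_lt1//; lra.
  move=> /cvgrPdist_lt /(_ _ d0) [N _ /(_ N (leqnn _))];
    rewrite sub0r normrN => h.
  by exists N; rewrite hn; apply: le_lt_trans h; rewrite ler_norm.
have := hd _ _ (s n).2 (introT andP (conj (inv n).1 hnd)) (hp n) (hq n).
by have := (inv n).2; lra.
Qed.

End Bisection.

(** * Integrals over intervals and squares, and the flux through a square *)

Section Rint.
Variable R : realType.

Lemma Rintegral_approx d (T : measurableType d) (mu : {measure set T -> \bar R})
    (D : set T) (f : T -> R) (k e : R) : measurable D -> (mu D < +oo)%E ->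
  mu.-integrable D (EFin \o f) -> (forall x, D x -> `|f x - k| <= e) ->
  `|Rintegral mu D f - k * fine (mu D)| <= e * fine (mu D).
Proof.
move=> mD fD iF h.
have ic (c : R) : mu.-integrable D (EFin \o cst c).
  apply: measurable_bounded_integrable => //.
  by exists `|c|; split; [rewrite num_real | move=> M cM x _; exact: ltW].
have h1 : Rintegral mu D f <= (k + e) * fine (mu D).
  rewrite -(Rintegral_cst mu mD); apply: le_Rintegral => //; first exact: ic.
  by move=> x /h; rewrite ler_norml /cst; lra.
have h2 : (k - e) * fine (mu D) <= Rintegral mu D f.
  rewrite -(Rintegral_cst mu mD); apply: le_Rintegral => //; first exact: ic.
  by move=> x /h; rewrite ler_norml /cst; lra.
by rewrite ler_norml; lra.
Qed.

Definition Rint (a b : R) (phi : R -> R) : R :=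
  \int[@lebesgue_measure R]_(t in `]a, b]) phi t.

Lemma Rint_integrable (a b : R) (phi : R -> R) : continuous phi ->
  (@lebesgue_measure R).-integrable `]a, b] (EFin \o phi).
Proof.
move=> cphi.
have h : (@lebesgue_measure R).-integrable `[a, b] (EFin \o phi).
  apply: continuous_compact_integrable; first exact: segment_compact.
  exact: continuous_subspaceT.
apply: (integrableS _ _ _ h) => //.
by apply: subset_itvr; rewrite bnd_simp.
Qed.

Lemma Rint_cat (a b c : R) (phi : R -> R) : continuous phi -> a <= b ->
  b <= c ->
  Rint a c phi = Rint a b phi + Rint b c phi.
Proof.
move=> cphi ab bc; rewrite /Rint.
rewrite -(@Rintegral_itvB _ phi (BRight a) (BRight c) b) ?bnd_simp//.
  by rewrite addrC subrK.
exact: Rint_integrable.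
Qed.

Lemma RintD (a b : R) (phi psi : R -> R) : continuous phi -> continuous psi ->
  Rint a b (fun t => phi t + psi t) = Rint a b phi + Rint a b psi.
Proof. by move=> c1 c2; apply: RintegralD => //; apply: Rint_integrable. Qed.

Lemma Rint_approx (a h k e : R) (phi : R -> R) : continuous phi -> 0 <= h ->
  (forall t, a <= t <= a + h -> `|phi t - k| <= e) ->
  `|Rint a (a + h) phi - k * h| <= e * h.
Proof.
move=> cphi h0 H.
have fm : fine (@lebesgue_measure R `]a, a + h]%classic) = h.
  rewrite lebesgue_measure_itv /= lte_fin; case: ltP => [_|] /=; first by lra.
  lra.
have fi : (@lebesgue_measure R `]a, (a + h)%R]%classic < +oo)%E.
  by rewrite lebesgue_measure_itv /=; case: ifP => // _; rewrite -EFinB ltry.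
rewrite -[X in _ * X]fm -[X in _ <= _ * X]fm; apply: Rintegral_approx => //.
- exact: Rint_integrable.
- by move=> x; rewrite /= in_itv /= => /andP[h1 h2]; apply: H; rewrite (ltW h1).
Qed.

End Rint.

Section Flux.
Variable R : realType.
Local Notation plane_type := (measurableTypeR R * measurableTypeR R)%type.

Definition area : {measure set plane_type -> \bar R} :=
  (@lebesgue_measure R \x @lebesgue_measure R)%E.

(** Half-open sides, so that a square is the disjoint union of its four quarters. *)
Definition rect (a b c d : R) : set plane_type := `]a, b] `*` `]c, d].

Lemma measurable_rect a b c d : measurable (rect a b c d).
Proof. by apply: measurableX. Qed.

Lemma area_rect a b c d : a <= b -> c <= d ->
  area (rect a b c d) = ((b - a) * (d - c))%:E.
Proof.
have L (x y : R) : x <= y -> @lebesgue_measure R `]x, y]%classic = (y - x)%:E.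
  move=> xy; rewrite lebesgue_measure_itv /= lte_fin; case: ltP => // yx.
  by congr (_%:E); lra.
move=> ab cd; rewrite EFinM -(L _ _ ab) -(L _ _ cd).
exact: product_measure1E.
Qed.

Lemma area_square x y h : 0 <= h ->
  area (rect x (x + h) y (y + h)) = (h * h)%:E.
Proof.
by move=> h0; rewrite area_rect ?lerDl//; congr (_%:E); ring.
Qed.

Lemma rect_catx a b c y z : a <= b -> b <= c ->
  rect a c y z = rect a b y z `|` rect b c y z.
Proof.
move=> ab bc; apply/seteqP; split => -[s t]; rewrite /rect /= !in_itv /=.
  by move=> [/andP[h1 h2] ->]; case: (leP s b) => h3; [left|right];
    rewrite ?h1 ?h2 ?h3.
move=> [[/andP[h1 h2] ->]|[/andP[h1 h2] ->]]; split => //;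
  rewrite ?h1 ?h2 ?andbT//=; lra.
Qed.

Lemma rect_caty a b x y z : x <= y -> y <= z ->
  rect a b x z = rect a b x y `|` rect a b y z.
Proof.
move=> ab bc; apply/seteqP; split => -[s t]; rewrite /rect /= !in_itv /=.
  by move=> [-> /andP[h1 h2]]; case: (leP t y) => h3; [left|right];
    rewrite ?h1 ?h2 ?h3.
move=> [[-> /andP[h1 h2]]|[-> /andP[h1 h2]]]; split => //;
  rewrite ?h1 ?h2 ?andbT//=; lra.
Qed.

Lemma Rintegral_rect_cat (D : plane_type ->
  R) x y h : area.-integrable setT (EFin \o D) ->
  0 <= h ->
  Rintegral area (rect x (x + (h + h)) y (y + (h + h))) D =
  Rintegral area (rect x (x + h) y (y + h)) D +
  Rintegral area (rect (x + h) (x + h + h) y (y + h)) D +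
  Rintegral area (rect x (x + h) (y + h) (y + h + h)) D +
  Rintegral area (rect (x + h) (x + h + h) (y + h) (y + h + h)) D.
Proof.
move=> iD h0.
have iS A : measurable A -> area.-integrable A (EFin \o D).
  by move=> mA; apply: (integrableS _ _ _ iD).
rewrite (@rect_catx x (x + h)); [|lra..].
rewrite !(@rect_caty _ _ y (y + h) (y + (h + h))); [|lra..].
have mr := measurable_rect.
rewrite !addrA !Rintegral_setU //.
- ring.
- by apply: iS; apply: measurableU.
- apply/disj_setPS => -[s t] []; rewrite /rect /= !in_itv /=; lra.
- by apply: iS; apply: measurableU.
- apply/disj_setPS => -[s t] []; rewrite /rect /= !in_itv /=; lra.
- exact: measurableU.
- exact: measurableU.
- by apply: iS; apply: measurableU; apply: measurableU.
- apply/disj_setPS => -[s t] []; rewrite /rect /= !in_itv /=; lra.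
Qed.

Variables F1 F2 : R -> R -> R.
Hypothesis cF1 : forall x, continuous (F1 x).
Hypothesis cF2 : forall y, continuous (F2^~ y).

(** Outward flux of the field ([F1], [F2]) through the boundary of the square with lower left corner
    (x, y) and side h, opposite sides being paired. *)
Definition flux x y h : R :=
  Rint y (y + h) (fun t => F1 (x + h) t - F1 x t) +
  Rint x (x + h) (fun t => F2 t (y + h) - F2 t y).

Lemma continuous_dF1 x x' : continuous (fun t => F1 x' t - F1 x t).
Proof. by move=> t; apply: cvgB; apply: cF1. Qed.

Lemma continuous_dF2 y y' : continuous (fun t => F2 t y' - F2 t y).
Proof. by move=> t; apply: cvgB; apply: cF2. Qed.

(** The contributions of the inner edges shared by two quarters cancel. *)
Lemma flux_cat x y h : 0 <= h ->
  flux x y (h + h) = flux x y h + flux (x + h) y h + flux x (y + h) h +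
    flux (x + h) (y + h) h.
Proof.
move=> h0; rewrite /flux.
have E1 a : Rint a (a + h) (fun t => F1 (x + (h + h)) t - F1 x t) =
  Rint a (a + h) (fun t => F1 (x + h + h) t - F1 (x + h) t) +
  Rint a (a + h) (fun t => F1 (x + h) t - F1 x t).
  rewrite -RintD; [|exact: continuous_dF1..].
  by congr (Rint _ _ _); apply/funext => t; rewrite addrA; ring.
have E2 a : Rint a (a + h) (fun t => F2 t (y + (h + h)) - F2 t y) =
  Rint a (a + h) (fun t => F2 t (y + h + h) - F2 t (y + h)) +
  Rint a (a + h) (fun t => F2 t (y + h) - F2 t y).
  rewrite -RintD; [|exact: continuous_dF2..].
  by congr (Rint _ _ _); apply/funext => t; rewrite addrA; ring.
rewrite (@Rint_cat _ y (y + h)); [|exact: continuous_dF1|lra..].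
rewrite (@Rint_cat _ x (x + h)); [|exact: continuous_dF2|lra..].
by rewrite !(addrA _ h h) -!(addrA _ h h) in E1 E2 *;
  rewrite !addrA in E1 E2 *; rewrite !E1 !E2; ring.
Qed.

Lemma flux_approx x y h k1 k2 (e : R) : 0 <= h ->
  (forall t, y <= t <= y + h -> `|F1 (x + h) t - F1 x t - k1 * h| <= e * h) ->
  (forall t, x <= t <= x + h -> `|F2 t (y + h) - F2 t y - k2 * h| <= e * h) ->
  `|flux x y h - (k1 + k2) * (h * h)| <= e * h * h *+ 2.
Proof.
move=> h0 H1 H2; rewrite /flux.
have := Rint_approx (@continuous_dF1 x (x + h)) h0 H1.
have := Rint_approx (@continuous_dF2 y (y + h)) h0 H2.
rewrite !ler_norml mulr2n; lra.
Qed.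

End Flux.

(** * The divergence theorem on a square under pointwise differentiability *)

Section Goursat.
Variable R : realType.
Local Notation plane_type := (measurableTypeR R * measurableTypeR R)%type.

(** Real differentiability at (p, q), with partial derivatives a and b. *)
Definition diff2 (F : R -> R -> R) (p q a b : R) := forall e : R, 0 < e ->
  exists2 d : R, 0 < d & forall x y, `|x - p| < d -> `|y - q| < d ->
    `|F x y - F p q - a * (x - p) - b * (y - q)| <= e * (`|x - p| + `|y - q|).

(** Subtracting the expansions at facing points of two opposite sides cancels the term along the
    side and leaves the normal derivative times h; so the flux is close to the divergence [a + d]
    times the area. *)
Lemma flux_diff2 (F1 F2 : R -> R -> R) p q a b c d :
  (forall x, continuous (F1 x)) -> (forall y, continuous (F2^~ y)) ->
  diff2 F1 p q a b -> diff2 F2 p q c d -> forall e, 0 < e ->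
  exists2 d0, 0 < d0 & forall x y h, 0 < h < d0 ->
    x <= p <= x + h -> y <= q <= y + h ->
    `|flux F1 F2 x y h - (a + d) * (h * h)| <= e * (h * h).
Proof.
(* Each expansion errs by at most (e / 8) 2h, a difference of two by (e / 2) h, and the two pairs of
   sides together by e h^2. *)
move=> c1 c2 D1 D2 e e0; have e8 : 0 < e / 8 by lra.
have [d1 d10 H1] := D1 _ e8; have [d2 d20 H2] := D2 _ e8.
exists (Num.min d1 d2); first by rewrite lt_min d10.
move=> x y h; rewrite lt_min => /and3P[h0 hd1 hd2] /andP[xp1 xp2] /andP[yq1
  yq2].
have near1 t s : t <= s <= t + h -> forall u, t <= u <= t + h -> `|u - s| <= h.
  by move=> /andP[h1 h2] u /andP[h3 h4]; rewrite ler_norml; lra.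
have nx := near1 x p (introT andP (conj xp1 xp2)).
have ny := near1 y q (introT andP (conj yq1 yq2)).
have nx0 := nx x ltac:(lra); have nxh := nx (x + h) ltac:(lra).
have ny0 := ny y ltac:(lra); have nyh := ny (y + h) ltac:(lra).
have e4 : e * (h * h) = e / 2 * h * h *+ 2 by rewrite mulr2n; field.
rewrite e4; apply: flux_approx => //; first exact: ltW.
- move=> t yt; have nt := ny t yt.
  have A1 := H1 (x + h) t ltac:(lra) ltac:(lra).
  have A2 := H1 x t ltac:(lra) ltac:(lra).
  have -> : F1 (x + h) t - F1 x t - a * h =
    (F1 (x + h) t - F1 p q - a * (x + h - p) - b * (t - q)) -
    (F1 x t - F1 p q - a * (x - p) - b * (t - q)) by ring.
  apply: le_trans (ler_normB _ _) _; nra.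
- move=> t yt; have nt := nx t yt.
  have A1 := H2 t (y + h) ltac:(lra) ltac:(lra).
  have A2 := H2 t y ltac:(lra) ltac:(lra).
  have -> : F2 t (y + h) - F2 t y - d * h =
    (F2 t (y + h) - F2 p q - c * (t - p) - d * (y + h - q)) -
    (F2 t y - F2 p q - c * (t - p) - d * (y - q)) by ring.
  apply: le_trans (ler_normB _ _) _; nra.
Qed.

Lemma itv_near (x h p s d : R) : x <= p <= x + h -> x <= s -> s <= x + h ->
  h < d -> `|s - p| < d.
Proof. by move=> /andP[? ?] ? ? ?; rewrite ltr_norml; lra. Qed.

(* The exceptional points of the vector field lie in sets A of arbitrarily
   small area; there only the trivial quadratic bounds hold. *)
Lemma goursat (F1 F2 : R -> R -> R) (D : plane_type -> R) (K x0 y0 L : R) :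
  0 < L ->
  (forall x, continuous (F1 x)) -> (forall y, continuous (F2^~ y)) ->
  (area R).-integrable setT (EFin \o D) -> 0 <= K ->
  (forall eta : R, 0 < eta -> exists A : set plane_type,
    [/\ measurable A, (area R A <= eta%:E)%E &
    forall p q,
    (exists a b c d, [/\ diff2 F1 p q a b, diff2 F2 p q c d &
      forall e : R, 0 < e -> exists2 d0 : R, 0 < d0 & forall x y,
        `|x - p| < d0 -> `|y - q| < d0 ->
         `|D (x, y) - (a + d)| <= e]) \/
    (exists2 d0 : R, 0 < d0 & forall x y h : R, 0 < h < d0 ->
      x <= p <= x + h -> y <= q <= y + h ->
       rect x (x + h) y (y + h) `<=` A /\
       `|flux F1 F2 x y h -
           Rintegral (area R) (rect x (x + h) y (y + h)) D| <= K * (h * h))]) ->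
  flux F1 F2 x0 y0 L = Rintegral (area R) (rect x0 (x0 + L) y0 (y0 + L)) D.
Proof.
move=> L0 c1 c2 iD K0 H.
apply/eqP; rewrite -subr_eq0 -normr_le0.
apply/ler_addgt0Pr => /= e e0; rewrite add0r.
have LL : 0 < L * L by rewrite mulr_gt0.
(* The error [e] is shared equally: one half for the exceptional set, at cost [K] per unit of area,
   the other for the whole square, at cost [eps] per unit of area. [K + 1] can be divided by even if
   K = 0. *)
have [eta eta0 heta] : exists2 eta : R, 0 < eta & (K + 1) * eta = e / 2.
  exists (e / 2 / (K + 1)); first by rewrite !divr_gt0//; lra.
  by rewrite mulrC divfK//; lra.
have [eps eps0 heps] : exists2 eps : R, 0 < eps & eps * (L * L) = e / 2.
  by exists (e / 2 / (L * L)); [rewrite !divr_gt0 | rewrite divfK// gt_eqF].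
have [A [mA fA HA]] := H _ eta0.
have iA : (area R).-integrable setT (EFin \o \1_A).
  apply/integrableP; split.
    by apply/measurable_EFinP; exact: measurable_indic.
  under eq_integral do rewrite /= ger0_norm//.
  by rewrite integral_indic// setIT; apply: le_lt_trans fA (ltry _).
have iS (f : plane_type -> R) B : (area R).-integrable setT (EFin \o f) ->
  measurable B -> (area R).-integrable B (EFin \o f).
  by move=> i0 mB; apply: (integrableS _ _ _ i0).
(* The defect of the divergence theorem minus the two allowances. Flux, integrals and area are
   additive over quarters, so [T] is subadditive. *)
pose T x y h :=
   `|flux F1 F2 x y h - Rintegral (area R) (rect x (x + h) y (y + h)) D|
   - eps * (h * h) - K * Rintegral (area R) (rect x (x + h) y (y + h)) \1_A.
have fin x y (h : R) : 0 <= h ->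
    fine (area R (rect x (x + h) y (y + h))) = h * h.
  by move=> h0; rewrite area_square.
have finl x y (h : R) : 0 <= h -> (area R (rect x (x + h) y (y + h)) < +oo)%E.
  by move=> h0; rewrite area_square// ltry.
have : T x0 y0 L <= 0.
  apply: bisection => //.
    move=> x y h h0; have h0' := ltW h0;
      rewrite /T flux_cat// !Rintegral_rect_cat//.
    set f1 := flux _ _ _ _ _; set f2 := flux _ _ _ _ _;
      set f3 := flux _ _ _ _ _; set f4 := flux _ _ _ _ _.
    set i1 := Rintegral _ _ D; set i2 := Rintegral _ _ D;
      set i3 := Rintegral _ _ D; set i4 := Rintegral _ _ D.
    have : `|f1 + f2 + f3 + f4 - (i1 + i2 + i3 + i4)| <= `|f1 - i1| +
      `|f2 - i2| + `|f3 - i3| + `|f4 - i4|.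
      have -> : f1 + f2 + f3 + f4 - (i1 + i2 + i3 + i4) = (f1 - i1) +
        (f2 - i2) + (f3 - i3) + (f4 - i4) by ring.
      by do 3 (apply: le_trans (ler_normD _ _) _; rewrite lerD2r).
    set m1 := Rintegral _ _ \1_A; set m2 := Rintegral _ _ \1_A;
      set m3 := Rintegral _ _ \1_A; set m4 := Rintegral _ _ \1_A.
    lra.
  move=> p q; case: (HA p q) => [[a [b [c [d [D1 D2 HD]]]]]|[d0 d00 hd]].
    have eps2 : 0 < eps / 2 by lra.
    have [d1 d10 hd1] := flux_diff2 c1 c2 D1 D2 eps2.
    have [d2 d20 hd2] := HD _ eps2.
    exists (Num.min d1 d2); first by rewrite lt_min d10.
    move=> x y h; rewrite lt_min => /and3P[h0 h1 h2] xp yq.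
    have B1 := hd1 x y h (introT andP (conj h0 h1)) xp yq.
    have B2 : `|Rintegral (area R) (rect x (x + h) y (y + h)) D - (a +
      d) * (h * h)| <= eps / 2 * (h * h).
      rewrite -(fin x y _ (ltW h0)); apply: Rintegral_approx.
      - exact: measurable_rect.
      - exact: (finl _ _ _ (ltW h0)).
      - by apply: iS => //; exact: measurable_rect.
      - move=> [s t]; rewrite /rect /= !in_itv /= =>
        -[/andP[s1 s2] /andP[t1 t2]].
        apply: hd2; [exact: (itv_near xp (ltW s1) s2 h2)|exact: (itv_near yq
          (ltW t1) t2 h2)].
    have B3 : 0 <= K * Rintegral (area R) (rect x (x + h) y (y + h)) \1_A.
      by rewrite mulr_ge0// Rintegral_ge0.
    rewrite /T; move: B1 B2; rewrite !ler_norml => B1 B2.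
    have : `|flux F1 F2 x y h -
        Rintegral (area R) (rect x (x + h) y (y + h)) D| <= eps * (h * h).
      by rewrite ler_norml; lra.
    lra.
  exists d0 => // x y h hd0 xp yq; have [sA B] := hd x y h hd0 xp yq.
  have h0 : 0 < h by case/andP: hd0.
  (* The square lies in [A], so the integral of the indicator is its full area h * h, which pays for
     the quadratic bound. *)
  have -> : T x y h = `|flux F1 F2 x y h - Rintegral (area R) (rect x (x +
    h) y (y + h)) D| - eps * (h * h) - K * (h * h).
    rewrite /T; congr (_ - _ * _).
    rewrite (@eq_Rintegral _ _ _ _ _ (cst 1)); last by move=> z;
      rewrite inE => /sA /mem_set ->.
    rewrite Rintegral_cst; last exact: measurable_rect.
    by rewrite mul1r fin // ltW.
  by have := mulr_gt0 eps0 (mulr_gt0 h0 h0); lra.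
rewrite /T => hT.
have : K * Rintegral (area R) (rect x0 (x0 + L) y0 (y0 + L)) \1_A <= e / 2.
  have B : Rintegral (area R) (rect x0 (x0 + L) y0 (y0 + L)) \1_A <= eta.
    rewrite /Rintegral integral_indic //; last exact: measurable_rect.
    rewrite -[eta]/(fine eta%:E); apply: fine_le => //.
    - rewrite ge0_fin_numE//; apply: le_lt_trans (_ : _ <= eta%:E)%E (ltry _).
      by apply: le_trans fA; apply: le_measure; rewrite ?inE//;
        apply: measurableI => //; exact: measurable_rect.
    - by apply: le_trans fA; apply: le_measure; rewrite ?inE//;
      apply: measurableI => //; exact: measurable_rect.
  by rewrite -heta; nra.
lra.
Qed.

End Goursat.

(** * Balls, annuli and continuous functions in the plane *)

Section PlaneTopology.
Variable R : realType.
Local Notation C := (Cx R).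
Local Notation plane_type := (measurableTypeR R * measurableTypeR R)%type.

Definition disk_open (U : set C) := forall z, U z ->
  exists2 d : R, 0 < d & forall w, cabs w < d -> U (w + z).

Lemma cabs_lt_sum (x y d : R) : `|x| < d / 2 -> `|y| < d / 2 ->
  cabs ((x +i* y)%C : C) < d.
Proof. by move=> h1 h2; apply: le_lt_trans (ler_cabs_ReIm _) _ => /=; lra. Qed.

Lemma plane_cabs_lt (p q : R * R) (d : R) : `|p.1 - q.1| < d / 2 ->
  `|p.2 - q.2| < d / 2 ->
  cabs (plane p - plane q) < d.
Proof.
move=> h1 h2; apply: le_lt_trans (ler_cabs_ReIm _) _.
by rewrite ReD ImD ReN ImN /=; lra.
Qed.

(** An open set is the countable union of the rectangles with rational corners that it contains; [F]
    replaces the other rectangles by the empty set. *)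
Lemma measurable_disk_open (U : set C) : disk_open U ->
  measurable ((@plane R) @^-1` U : set plane_type).
Proof.
move=> oU; set V := _ @^-1` _.
pose F (a b c d : rat) : set plane_type :=
  if pselect (rect (ratr a) (ratr b) (ratr c) (ratr d) `<=` V) then
    rect (ratr a) (ratr b) (ratr c) (ratr d : R) else set0.
have -> : V = \bigcup_a \bigcup_b \bigcup_c \bigcup_d F a b c d.
  apply/seteqP; split; last first.
    move=> p [a _ [b _ [c _ [d _]]]]; rewrite /F; case: pselect => //= h;
      exact: h.
  move=> p Vp; have [e e0 he] := oU _ Vp.
  have e2 : 0 < e / 2 by lra.
  have [a] := @rat_in_itvoo R (p.1 - e / 2) p.1 ltac:(lra).
  have [b] := @rat_in_itvoo R p.1 (p.1 + e / 2) ltac:(lra).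
  have [c] := @rat_in_itvoo R (p.2 - e / 2) p.2 ltac:(lra).
  have [d] := @rat_in_itvoo R p.2 (p.2 + e / 2) ltac:(lra).
  rewrite !in_itv /= => /andP[d1 d2] /andP[c1 c2] /andP[b1 b2] /andP[a1 a2].
  exists a => //; exists b => //; exists c => //; exists d => //.
  rewrite /F; case: pselect => [?|ns] /=.
    by rewrite /rect /= !in_itv /= a2 c2 !ltW.
  apply: ns => q; rewrite /rect /= !in_itv /= => -[/andP[q1 q2] /andP[q3 q4]].
  rewrite /V /= -(subrK (plane p) (plane q)); apply: he; apply: plane_cabs_lt.
    by rewrite ltr_norml; lra.
  by rewrite ltr_norml; lra.
apply: bigcupT_measurable_rat => a; apply: bigcupT_measurable_rat => b.
apply: bigcupT_measurable_rat => c; apply: bigcupT_measurable_rat => d.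
by rewrite /F; case: pselect => //= ?; exact: measurable_rect.
Qed.

Definition ccont (u : C -> C) z := forall e : R, 0 < e ->
  exists2 d : R, 0 < d & forall w, cabs w < d -> cabs (u (w + z) - u z) < e.

Lemma measurable_fun_plane (U : set C) (f : C -> R) : disk_open U ->
  (forall z, U z -> forall e : R, 0 < e ->
     exists2 d : R, 0 < d & forall w, cabs w < d -> `|f (w + z) - f z| < e) ->
  measurable_fun ((@plane R) @^-1` U : set plane_type) (fun p => f (plane p)).
Proof.
move=> oU cf; apply: (measurability _ (RGenOInfty.measurableE R)).
move=> /= _ [_ [a ->]] <-.
rewrite [X in measurable X](_ : _ = (@plane R) @^-1` (U `&` [set z | a < f z]));
  last first.
  by apply/seteqP; split => p /=; rewrite /= in_itv /= andbT.
apply: measurable_disk_open => z [Uz /= az].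
have [d1 d10 h1] := oU _ Uz.
have [d2 d20 h2] := cf _ Uz (f z - a) ltac:(lra).
exists (Num.min d1 d2); first by rewrite lt_min d10.
move=> w; rewrite lt_min => /andP[w1 w2]; split; first exact: h1.
by have := h2 w w2; rewrite /= ltr_norml; lra.
Qed.

Lemma disk_open_ball (r : R) : disk_open [set z : C | cabs z < r].
Proof.
move=> z /= zr; exists (r - cabs z); first by lra.
by move=> w wr; apply: le_lt_trans (ler_cabsD _ _) _; lra.
Qed.

Lemma ccont_Re (u : C -> C) z : ccont u z -> forall e : R, 0 < e ->
  exists2 d : R, 0 < d & forall w, cabs w < d ->
    `|complex.Re (u (w + z)) - complex.Re (u z)| < e.
Proof.
move=> cu e e0; have [d d0 hd] := cu e e0; exists d => // w wd.
by rewrite -ReN -ReD; apply: le_lt_trans (ler_Re_cabs _) (hd w wd).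
Qed.

Lemma ccont_Im (u : C -> C) z : ccont u z -> forall e : R, 0 < e ->
  exists2 d : R, 0 < d & forall w, cabs w < d ->
    `|complex.Im (u (w + z)) - complex.Im (u z)| < e.
Proof.
move=> cu e e0; have [d d0 hd] := cu e e0; exists d => // w wd.
by rewrite -ImN -ImD; apply: le_lt_trans (ler_Im_cabs _) (hd w wd).
Qed.

Definition pball (r : R) : set plane_type :=
  (@plane R) @^-1` [set z | cabs z < r].

Lemma measurable_pball r : measurable (pball r).
Proof. by apply: measurable_disk_open; exact: disk_open_ball. Qed.

Lemma plane_diskE : plane_disk R = pball 1.
Proof. by apply/seteqP; split => p h;
  [exact/(diskE (plane p))|exact/(diskE (plane p))]. Qed.

Lemma pball_rect r : r <= 1 -> pball r `<=` rect (- 1) 1 (- 1) 1.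
Proof.
move=> r1 p pr; rewrite /pball /= in pr.
have h1 := ler_Re_cabs (plane p); have h2 := ler_Im_cabs (plane p).
rewrite /rect /= !in_itv /=; move: h1 h2; rewrite !ler_norml /= => h1 h2.
by split; lra.
Qed.

Lemma area_pball_lty r : r <= 1 -> (area R (pball r) < +oo)%E.
Proof.
move=> r1; apply: le_lt_trans (_ : _ <= area R (rect (- 1) 1 (- 1) 1))%E _.
  by apply: le_measure; rewrite ?inE;
    [exact: measurable_pball|exact: measurable_rect|exact: pball_rect].
by rewrite area_rect ?ltry//; lra.
Qed.

Lemma integrable_pball (r : R) (f : C -> R) (K : R) : r <= 1 ->
  (forall z, cabs z < r -> forall e : R, 0 < e ->
     exists2 d : R, 0 < d & forall w, cabs w < d -> `|f (w + z) - f z| < e) ->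
  (forall z, cabs z < r -> `|f z| <= K) ->
  (area R).-integrable (pball r) (fun p => (f (plane p))%:E).
Proof.
move=> r1 cf bf; apply: measurable_bounded_integrable.
- exact: measurable_pball.
- exact: area_pball_lty.
- by apply: measurable_fun_plane cf; exact: disk_open_ball.
- exists K; split; first exact: num_real.
  by move=> M KM p pr; apply: le_trans (ltW KM); exact: bf.
Qed.

(* Bisection replaces compactness: the bad squares are those on which u is
   unbounded. *)
Lemma bounded_pball (r : R) (u : C -> C) : r < 1 ->
  (forall z, cabs z < 1 -> ccont u z) ->
  exists K : R, 0 <= K /\ forall z, cabs z <= r -> cabs (u z) <= K.
Proof.
move=> r1 cu.
pose P x y h := exists K : R, 0 <= K /\ forall z : C,
  x <= complex.Re z <= x + h ->
   y <= complex.Im z <= y + h -> cabs z <= r -> cabs (u z) <= K.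
(* Unboundedness as a number, 0 or 1, to which [bisection] applies: subadditivity says that a square
   with four bounded quarters is bounded. *)
pose T x y h : R := if pselect (P x y h) then 0 else 1.
have TP x y h : T x y h <= 0 -> P x y h.
  by rewrite /T; case: pselect => //= _; rewrite ler10.
have PT x y h : P x y h -> T x y h = 0 by rewrite /T; case: pselect.
have T0 x y h : 0 <= T x y h by rewrite /T; case: pselect.
have : T (- 1) (- 1) 2 <= 0.
  apply: bisection => //.
    move=> x y h h0.
    have [p1|n1] := pselect (P x y h); last first.
      rewrite {2}/T; case: pselect => //= _; apply: le_trans (_ : _ <= 1) _;
        first by rewrite /T; case: pselect.
      by rewrite -!addrA lerDl !addr_ge0.
    have [p2|n2] := pselect (P (x + h) y h); last first.
      rewrite {3}/T; case: pselect => //= _; apply: le_trans (_ : _ <= 1) _;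
        first by rewrite /T; case: pselect.
      by rewrite (addrC (T x y h)) -!addrA lerDl !addr_ge0.
    have [p3|n3] := pselect (P x (y + h) h); last first.
      rewrite {4}/T; case: pselect => //= _; apply: le_trans (_ : _ <= 1) _;
        first by rewrite /T; case: pselect.
      by rewrite addrAC lerDr !addr_ge0.
    have [p4|n4] := pselect (P (x + h) (y + h) h); last first.
      rewrite {5}/T; case: pselect => //= _; apply: le_trans (_ : _ <= 1) _;
        first by rewrite /T; case: pselect.
      by rewrite lerDr !addr_ge0.
    rewrite (PT _ _ _ p1) (PT _ _ _ p2) (PT _ _ _ p3) (PT _ _ _ p4) !addr0 PT//.
    move: p1 p2 p3 p4 => [K1 [K10 h1]] [K2 [K20 h2]] [K3 [K30 h3]] [K4 [K40
      h4]].
    exists (K1 + K2 + K3 + K4); split; first by rewrite !addr_ge0.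
    move=> z /andP[z1 z2] /andP[z3 z4] zr.
    have [a1|a1] := leP (complex.Re z) (x + h);
      have [a2|a2] := leP (complex.Im z) (y + h).
    - by have := h1 z (introT andP (conj z1 a1)) (introT andP (conj z3 a2)) zr;
      lra.
    - by have := h3 z (introT andP (conj z1 a1)) ltac:(lra) zr; lra.
    - by have := h2 z ltac:(lra) (introT andP (conj z3 a2)) zr; lra.
    - by have := h4 z ltac:(lra) ltac:(lra) zr; lra.
  move=> p q; pose z : C := (p +i* q)%C.
  have sq (x y h d : R) (w : C) : h < d / 2 -> x <= p <= x + h ->
    y <= q <= y + h ->
    x <= complex.Re w <= x + h -> y <= complex.Im w <= y + h ->
      cabs (w - z) < d.
    move=> hd /andP[xp1 xp2] /andP[yq1 yq2] /andP[w1 w2] /andP[w3 w4].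
    apply: le_lt_trans (ler_cabs_ReIm _) _; rewrite ReD ImD ReN ImN /=.
    have : `|complex.Re w - p| <= h by rewrite ler_norml; lra.
    have : `|complex.Im w - q| <= h by rewrite ler_norml; lra.
    lra.
  have [z1|z1] := ltP (cabs z) 1.
    have [d d0 hd] := cu z z1 1 ltr01.
    exists (d / 2) => [|x y h /andP[h0 hh] xp yq]; first by lra.
    rewrite PT//; exists (cabs (u z) + 1); split; first by rewrite addr_ge0.
    move=> w wx wy _; have := hd (w - z) (sq _ _ _ _ _ hh xp yq wx wy).
    by rewrite subrK; have := ler_sub_cabs (u w) (u z); lra.
  (* Near a point with |z| >= 1 small squares miss the closed disk of radius r, so the bound K = 0
     holds vacuously. *)
  exists ((1 - r) / 2) => [|x y h /andP[h0 hh] xp yq]; first by lra.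
  rewrite PT//; exists 0; split => // w wx wy wr; exfalso.
  have := sq _ _ _ _ _ hh xp yq wx wy; rewrite cabs_sub.
  by have := ler_sub_cabs z w; lra.
move=> /TP [K [K0 hK]]; exists K; split => // z zr.
have := ler_Re_cabs z; have := ler_Im_cabs z; rewrite !ler_norml => h1 h2.
by apply: hK => //; lra.
Qed.

Lemma cdiff_ccont (u : C -> C) z A : cdiff u z A -> ccont u z.
Proof.
move=> h e e0; have [d d0 hd] := h 1 ltr01.
have A0 := cabs_ge0 A; have A2 : 0 < cabs A + 2 by lra.
exists (Num.min d (e / (cabs A + 2))); first by rewrite lt_min d0 divr_gt0.
move=> w; rewrite lt_min => /andP[w1 w2]; have h1 := hd w w1.
rewrite -(subrK (A * w) (u (w + z) - u z));
  apply: le_lt_trans (ler_cabsD _ _) _; rewrite cabsM.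
move: w2; rewrite ltr_pdivlMr//; have := cabs_ge0 w; nra.
Qed.

Lemma analyticP (u : C -> C) : analytic u -> forall z, cabs z < 1 ->
  cdiff u z (derive1 u z).
Proof.
move=> au z /diskE zd; apply/cdiffP; apply: DeriveDef; first exact: au.
by rewrite derive1E.
Qed.

Lemma analytic_ccont (u : C -> C) : analytic u -> forall z, cabs z < 1 ->
  ccont u z.
Proof. by move=> au z z1; exact: cdiff_ccont (analyticP au z1). Qed.

Definition annulus (r e : R) : set plane_type :=
  (@plane R) @^-1` [set z | `|cabs z - r| < e].

Lemma measurable_annulus r e : measurable (annulus r e).
Proof.
apply: measurable_disk_open => z /= zr; exists (e - `|cabs z - r|);
  first by lra.
move=> w hw.
have h1 := ler_cabsD w z; have h2 := ler_sub_cabs z (w + z).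
have h3 : cabs (z - (w + z)) = cabs w by rewrite cabs_sub addrK.
have h4 : `|cabs (w + z) - cabs z| <= cabs w by rewrite ler_norml; lra.
by apply: le_lt_trans (ler_distD (cabs z) _ _) _; lra.
Qed.

(** By Fubini: the section at abscissa x has at most the two points sqrt(r^2 - x^2) and its
    opposite. *)
Lemma area_circle (r : R) : area R [set p | cabs (plane p) = r] = 0.
Proof.
rewrite /area /= /product_measure1 /=; apply: integral0_eq => x _ /=.
apply: countable_lebesgue_measure0; apply: finite_set_countable.
apply: (@sub_finite_set _ _ ([set Num.sqrt (r ^+ 2 - x ^+ 2)] `|` [set -
  Num.sqrt (r ^+ 2 - x ^+ 2)])).
  move=> y; rewrite /xsection /= inE /= => xyr.
  have -> : r ^+ 2 - x ^+ 2 = y ^+ 2 by have h : cabs (plane (x, y)) = r by [];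
    rewrite -h sqr_cabs /=; ring.
  rewrite sqrtr_sqr; case: (ger0P y) => _; [by left|right].
  by rewrite opprK.
by rewrite finite_setU.
Qed.

(** Continuity of the measure from above, along annuli shrinking to the circle. Half-widths of at
    most 1 - r keep them in the unit disk, hence of finite area. *)
Lemma area_annulus (r : R) : 0 < r < 1 -> forall eta : R, 0 < eta ->
  exists2 e : R, 0 < e & (area R (annulus r e) <= eta%:E)%E.
Proof.
move=> /andP[r0 r1] eta eta0.
pose F n := annulus r ((1 - r) / n.+1%:R).
have capF : \bigcap_n F n = [set p | cabs (plane p) = r].
  apply/seteqP; split => p.
    move=> hp /=; apply/eqP; rewrite -subr_eq0 -normr_le0;
      apply/ler_addgt0Pr => e e0.
    rewrite add0r.
    have h : (1 - r) / n.+1%:R @[n --> \oo] --> (0 : R).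
      rewrite -[X in _ --> X](mulr0 (1 - r)); apply: cvgMr; exact: cvg_harmonic.
    move: h => /cvgrPdist_lt /(_ _ e0) [N _ /(_ N (leqnn _))];
      rewrite sub0r normrN => hN.
    have := hp N I; rewrite /F /annulus /= => H.
    apply: ltW; apply: lt_trans H _; apply: le_lt_trans hN; exact: ler_norm.
  move=> /= pr n _; rewrite /F /annulus /= pr subrr normr0 divr_gt0 ?ltr0n//;
    lra.
have cv : (area R \o F) n @[n --> \oo] --> area R (\bigcap_n F n).
  apply: nonincreasing_cvg_mu.
  - apply: le_lt_trans (area_pball_lty (lexx 1)).
    apply: le_measure; rewrite ?inE;
      [exact: measurable_annulus|exact: measurable_pball|].
    move=> p; rewrite /F /annulus /pball /= divr1 ltr_norml; lra.
  - by move=> i; exact: measurable_annulus.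
  - by apply: bigcap_measurable => // i _; exact: measurable_annulus.
  - move=> m n mn; apply/subsetPset => p; rewrite /F /annulus /= => h;
    apply: lt_le_trans h _.
    apply: ler_wpM2l; first by lra.
    by rewrite lef_pV2 ?posrE ?ltr0n// ler_nat.
have := cv; rewrite capF area_circle =>
  /fine_cvgP[[N1 _ h1]] /cvgrPdist_lt /(_ _ eta0) [N2 _ h2].
pose n := (N1 + N2)%N.
exists ((1 - r) / n.+1%:R); first by rewrite divr_gt0 ?ltr0n//; lra.
have f1 : area R (F n) \is a fin_num by apply: h1; rewrite /n /= leq_addr.
have := h2 n (leq_addl _ _); rewrite sub0r normrN /= => h3.
rewrite -/(F n) -(fineK f1) lee_fin; apply: ltW; apply: le_lt_trans h3;
  exact: ler_norm.
Qed.

End PlaneTopology.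

(** * Integrals of d-bar derivatives over disks *)

Section Stokes.
Variable R : realType.
Local Notation C := (Cx R).
Local Notation plane_type := (measurableTypeR R * measurableTypeR R)%type.

(* A and B are the Wirtinger derivatives of u at z. *)
Definition wdiff (u : C -> C) (z A B : C) := forall e : R, 0 < e ->
  exists2 d : R, 0 < d & forall w, cabs w < d ->
    cabs (u (w + z) - u z - A * w - B * w^*) <= e * cabs w.

Lemma cdiff_wdiff (u : C -> C) z A : cdiff u z A -> wdiff u z A 0.
Proof.
by move=> h e e0; have [d d0 hd] := h e e0; exists d => // w /hd;
  rewrite mul0r subr0.
Qed.

Lemma wdiff_ccont (u : C -> C) z A B : wdiff u z A B -> ccont u z.
Proof.
move=> h e e0; have [d d0 hd] := h 1 ltr01.
have A0 := cabs_ge0 A; have B0 := cabs_ge0 B.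
have A2 : 0 < cabs A + cabs B + 2 by lra.
exists (Num.min d (e / (cabs A + cabs B + 2)));
  first by rewrite lt_min d0 divr_gt0.
move=> w; rewrite lt_min => /andP[w1 w2]; have h1 := hd w w1.
rewrite -(subrK (A * w) (u (w + z) - u z)) -(subrK (B * w^*) (u (w +
  z) - u z - A * w)).
apply: le_lt_trans (ler_cabsD _ _) _.
apply: le_lt_trans (lerD (ler_cabsD _ _) (lexx _)) _; rewrite !cabsM cabs_conj.
move: w2; rewrite ltr_pdivlMr//; have := cabs_ge0 w; nra.
Qed.

Lemma wdiffD (u v : C -> C) z A B A' B' : wdiff u z A B -> wdiff v z A' B' ->
  wdiff (fun x => u x + v x) z (A + A') (B + B').
Proof.
move=> hu hv e e0; have e2 : 0 < e / 2 by lra.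
have [d1 d10 h1] := hu _ e2; have [d2 d20 h2] := hv _ e2.
exists (Num.min d1 d2); first by rewrite lt_min d10.
move=> w; rewrite lt_min => /andP[w1 w2].
rewrite [X in cabs X <= _](_ : _ = (u (w + z) - u z - A * w - B * w^*) +
  (v (w + z) - v z - A' * w - B' * w^*)); last by ring.
apply: le_trans (ler_cabsD _ _) _.
by have := h1 w w1; have := h2 w w2; lra.
Qed.

Lemma wdiffZ (c : C) (u : C -> C) z A B : wdiff u z A B ->
  wdiff (fun x => c * u x) z (c * A) (c * B).
Proof.
move=> hu e e0; have c0 := cabs_ge0 c; have c1 : 0 < cabs c + 1 by lra.
have e2 : 0 < e / (cabs c + 1) by rewrite divr_gt0.
have [d1 d10 h1] := hu _ e2; exists d1 => // w w1.
rewrite [X in cabs X <= _](_ : _ = c * (u (w + z) - u z - A * w - B * w^*));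
  last by ring.
rewrite cabsM; apply: le_trans (_ : (cabs c + 1) * cabs (u (w +
  z) - u z - A * w - B * w^*) <= _).
  by rewrite ler_wpM2r//; lra.
by have := h1 w w1; rewrite mulrAC ler_pdivlMr// mulrC.
Qed.

(* The conjugate of v has Wirtinger derivatives 0 and conj v',
  whence the product rule. *)
Lemma wdiff_mul_conj (u v : C -> C) z A B : cdiff u z A -> cdiff v z B ->
  wdiff (fun x => u x * (v x)^*) z (A * (v z)^*) (u z * B^*).
Proof.
move=> hu hv e e0.
pose N := cabs (u z) + cabs A + cabs (v z) + cabs B + 1.
have := cabs_ge0 (u z); have := cabs_ge0 (v z); have := cabs_ge0 A;
  have := cabs_ge0 B.
move=> B0 A0 v0 u0.
have [N0 [Nu NA] [Nv NB]] : [/\ 0 < N,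
  cabs (u z) <= N /\ cabs A <= N & cabs (v z) <= N /\ cabs B <= N].
  by rewrite /N; split; [|split|split]; lra.
pose e' := e / (4 * N).
have e'0 : 0 < e' by rewrite divr_gt0// mulr_gt0.
have e'N : e' * N * 4 = e by rewrite /e'; field; rewrite gt_eqF.
move: e'0 e'N; move: e' => e' e'0 e'N.
have [d1 d10 h1] := hu _ e'0; have [d2 d20 h2] := hv _ ltr01.
have [d3 d30 h3] := hv _ e'0.
pose d4 := e / (4 * (N * (N + 1))).
have d40 : 0 < d4 by rewrite !(divr_gt0, mulr_gt0)//; lra.
have d4N : d4 * (N * (N + 1)) * 4 = e.
  by rewrite /d4; field; apply/andP; split; rewrite gt_eqF//; lra.
have [d5 d50 h5] : exists2 d5 : R, 0 < d5 & d5 * (e' * (N + 1)) <= e / 4.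
  exists (e / (4 * (e' * (N + 1)))); first by rewrite !(divr_gt0, mulr_gt0)//;
    lra.
  rewrite le_eqVlt; apply/orP; left; apply/eqP; field.
  by apply/andP; split; rewrite gt_eqF//; lra.
exists (Num.min (Num.min d1 (Num.min d2 d3)) (Num.min d4 d5));
  first by rewrite !lt_min d10 d20 d30 d40.
move=> w; rewrite !lt_min => /andP[/and3P[w1 w2 w3] /andP[w4 w5]].
have {}h1 := h1 w w1; have {}h2 := h2 w w2; have {}h3 := h3 w w3.
set du := u (w + z) - u z - A * w in h1.
set dv := v (w + z) - v z - B * w in h2 h3.
(* The remainder of the product has four terms, each at most (e / 4) |w|: two contain one small
   remainder [du] or [dv] times a bounded factor, the other two are quadratic in w. *)
rewrite [X in cabs X <= _](_ : _ = du * (v z)^* + u z * dv^* +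
    (A * w) * (B * w + dv)^* + du * (B * w + dv)^*); last first.
  by rewrite /du /dv !(rmorphB, rmorphD, rmorphM) /=; ring.
have hB : cabs (B * w + dv) <= (N + 1) * cabs w.
  apply: le_trans (ler_cabsD _ _) _; rewrite cabsM; have := cabs_ge0 w; nra.
have w0 := cabs_ge0 w.
have t1 : cabs (du * (v z)^*) <= e / 4 * cabs w.
  rewrite cabsM cabs_conj; apply: le_trans (_ : (e' * cabs w) * N <= _);
    first exact: ler_pM.
  by rewrite -e'N; nra.
have t2 : cabs (u z * dv^*) <= e / 4 * cabs w.
  rewrite cabsM cabs_conj; apply: le_trans (_ : N * (e' * cabs w) <= _);
    first exact: ler_pM.
  by rewrite -e'N; nra.
have t3 : cabs ((A * w) * (B * w + dv)^*) <= e / 4 * cabs w.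
  rewrite !cabsM cabs_conj; apply: le_trans (_ : (N * cabs w) * ((N +
    1) * cabs w) <= _).
    by apply: ler_pM => //; [rewrite mulr_ge0 | rewrite ler_wpM2r].
  have -> : N * cabs w * ((N + 1) * cabs w) = cabs w * (N * (N +
    1)) * cabs w by ring.
  rewrite ler_wpM2r//; apply: le_trans (_ : d4 * (N * (N + 1)) <= _);
    last by lra.
  by rewrite ler_wpM2r ?mulr_ge0//; lra.
have t4 : cabs (du * (B * w + dv)^*) <= e / 4 * cabs w.
  rewrite !cabsM cabs_conj; apply: le_trans (_ : (e' * cabs w) * ((N +
    1) * cabs w) <= _).
    exact: ler_pM.
  have -> : e' * cabs w * ((N + 1) * cabs w) = cabs w * (e' * (N +
    1)) * cabs w by ring.
  rewrite ler_wpM2r//; apply: le_trans h5; rewrite ler_wpM2r ?mulr_ge0//; lra.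
apply: le_trans (ler_cabsD _ _) _.
apply: le_trans (lerD (ler_cabsD _ _) (lexx _)) _.
apply: le_trans (lerD (lerD (ler_cabsD _ _) (lexx _)) (lexx _)) _.
lra.
Qed.

(** For w = s + i t, A w + B conj(w) = (A + B) s + i (A - B) t; the partial derivatives are read off
    the real part. *)
Lemma diff2_Re (u : C -> C) (p q : R) A B : wdiff u (p +i* q)%C A B ->
  diff2 (fun x y => complex.Re (u (x +i* y)%C)) p q
    (complex.Re (A + B)) (- complex.Im (A - B)).
Proof.
move=> hu e e0; have [d d0 hd] := hu e e0; exists (d / 2); first by lra.
move=> x y xp yq; pose w : C := ((x - p) +i* (y - q))%C.
have wz : w + (p +i* q)%C = (x +i* y)%C :> C.
  by rewrite /w; congr (_ +i* _)%C; rewrite /= subrK.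
have wd : cabs w < d by apply: cabs_lt_sum.
have := hd w wd; rewrite wz => h.
apply: le_trans (_ : _ <= cabs (u (x +i* y)%C - u (p +i* q)%C - A * w - B *
  w^*)) _.
  apply: le_trans (ler_Re_cabs _); rewrite le_eqVlt; apply/orP; left;
    apply/eqP; congr (`| _ |).
  by rewrite !ReD !ReN !cReM !ImD !ImN cRe_conj cIm_conj /=; ring.
by apply: le_trans h _; rewrite ler_wpM2l ?(ltW e0)// ler_cabs_ReIm.
Qed.

Lemma diff2_ext (F G : R -> R -> R) p q a b (d : R) : 0 < d ->
  (forall x y, `|x - p| < d -> `|y - q| < d -> F x y = G x y) ->
  diff2 F p q a b -> diff2 G p q a b.
Proof.
move=> d0 FG hF e e0; have [d1 d10 h1] := hF e e0.
exists (Num.min d d1); first by rewrite lt_min d0.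
move=> x y; rewrite !lt_min => /andP[x1 x2] /andP[y1 y2].
by rewrite -!FG ?subrr ?normr0//; apply: h1.
Qed.

(** Let [v] be u extended by zero. The field (Re v, - Im v) has divergence Re (A + B) - Re (A - B) =
    2 Re B in the disk, and its flux through the boundary of the square of side 2 around the disk is
    0. The linear decay of u tames the circle, where [v] need not be differentiable. *)
Lemma stokes_disk_Re (u B : C -> C) (r K : R) : 0 < r < 1 -> 0 <= K ->
  (forall z, cabs z < r -> exists A, wdiff u z A (B z)) ->
  (forall z, cabs z < r -> ccont B z) ->
  (forall z, cabs z < r -> cabs (B z) <= K) ->
  (forall z, cabs z < r -> cabs (u z) <= K * (r - cabs z)) ->
  Rintegral (area R) (pball r) (fun p => complex.Re (B (plane p))) = 0.
Proof.
move=> /andP[r0 r1] K0 du cB bB bu.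
pose v z := if cabs z < r then u z else 0.
(* If z is not in the disk while w + z is, then w + z lies within |w| of the circle, and the decay
   of u applies. *)
have vK (z w : C) : r <= cabs z -> cabs (v (w + z)) <= K * cabs w.
  move=> rz; rewrite /v; case: ifP => [h|_]; last by rewrite cabs0 mulr_ge0.
  apply: le_trans (bu _ h) _; apply: ler_wpM2l => //.
  have := ler_sub_cabs z (w + z); rewrite [z - _]addrC opprD -addrA addNr addr0
    cabsN; lra.
have cv z : ccont v z.
  move=> e e0; have [zr|zr] := ltP (cabs z) r.
    have [A hA] := du z zr; have [d d0 hd] := wdiff_ccont hA e0.
    exists (Num.min d (r - cabs z)); first by rewrite lt_min d0 subr_gt0.
    move=> w; rewrite lt_min => /andP[w1 w2]; rewrite /v zr ifT;
      first exact: hd.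
    by apply: le_lt_trans (ler_cabsD _ _) _; lra.
  have K1 : 0 < K + 1 by lra.
  exists (e / (K + 1)); first by rewrite divr_gt0.
  move=> w; rewrite ltr_pdivlMr// => w1.
  have -> : v z = 0 by rewrite /v ifF// ltNge zr.
  rewrite subr0; apply: le_lt_trans (vK _ _ zr) _; have := cabs_ge0 w; nra.
have cline (t : R) (l : R -> C) : (forall s, cabs (l s - l t) <= `|s - t|) ->
    forall e : R, 0 < e -> \forall s \near t, cabs (v (l s) - v (l t)) < e.
  move=> hl e e0; have [d d0 hd] := cv (l t) e e0.
  apply/nbhs_ballP; exists d => // s; rewrite /ball /= distrC => st.
  by have := hd (l s - l t) (le_lt_trans (hl s) st); rewrite subrK.
have clx (x s t : R) : cabs ((x +i* s)%C - (x +i* t)%C : C) <= `|s - t|.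
  by apply: le_trans (ler_cabs_ReIm _) _;
    rewrite ReD ReN ImD ImN /= subrr normr0 add0r.
have cly (y s t : R) : cabs ((s +i* y)%C - (t +i* y)%C : C) <= `|s - t|.
  by apply: le_trans (ler_cabs_ReIm _) _;
    rewrite ReD ReN ImD ImN /= subrr normr0 addr0.
pose F1 (x y : R) := complex.Re (v (x +i* y)%C).
pose F2 (x y : R) := - complex.Im (v (x +i* y)%C).
pose D : plane_type -> R := (fun p =>
  2 * complex.Re (B (plane p))) \_ (pball r).
have c1 x : continuous (F1 x).
  move=> t; apply/cvgrPdist_lt => e e0.
  have := cline t (fun s => (x +i* s)%C) (clx x ^~ t) e e0;
    apply: filterS => s hs.
  by rewrite /F1 distrC -ReN -ReD; apply: le_lt_trans (ler_Re_cabs _) hs.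
have c2 y : continuous (F2^~ y).
  move=> t; apply/cvgrPdist_lt => e e0.
  have := cline t (fun s => (s +i* y)%C) (cly y ^~ t) e e0;
    apply: filterS => s hs.
  rewrite /F2 opprK addrC -ImN -ImD; apply: le_lt_trans (ler_Im_cabs _) hs.
have iB : (area R).-integrable (pball r) (fun p =>
  (2 * complex.Re (B (plane p)))%:E).
  apply: (@integrable_pball R r (fun z => 2 * complex.Re (B z)) (2 * K));
    first exact: ltW.
    move=> z zr e e0; have e2 : 0 < e / 2 by lra.
    have [d d0 hd] := ccont_Re (cB z zr) e2; exists d => // w /hd.
    by rewrite !ltr_norml; lra.
  move=> z zr; rewrite normrM ger0_norm// ler_wpM2l//.
  by apply: le_trans (ler_Re_cabs _) (bB z zr).
have iD : (area R).-integrable setT (EFin \o D).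
  have : (area R).-integrable setT ((fun p =>
    (2 * complex.Re (B (plane p)))%:E) \_ (pball r)).
    by rewrite -integrable_mkcond//; exact: measurable_pball.
  by rewrite restrict_EFin.
have bD p : `|D p| <= 2 * K.
  rewrite /D patchE; case: ifPn => [/[!inE] pr|_];
    last by rewrite normr0 mulr_ge0.
  rewrite normrM ger0_norm// ler_wpM2l//.
  by apply: le_trans (ler_Re_cabs _) (bB _ pr).
have main : flux F1 F2 (-1) (-1) 2 = Rintegral (area R) (rect (-1) (-1 +
  2) (-1) (-1 + 2)) D.
  (* On squares touching the circle the flux is at most 8 K h^2 and the integral of [D] at most 2 K
     h^2. *)
  apply: (@goursat R F1 F2 D (10 * K)) => //; first by rewrite mulr_ge0.
  move=> eta eta0.
  have [eps eps0 heps] := area_annulus (introT andP (conj r0 r1)) eta0.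
  exists (annulus r eps); split => //; first exact: measurable_annulus.
  move=> p q; pose z : C := (p +i* q)%C.
  (* Inside the disk the field is differentiable with divergence [D]; outside, everything vanishes
     locally; on the circle only the quadratic bounds are available. *)
  have [zr|zr|zr] := ltgtP (cabs z) r.
  - left; have [A hA] := du z zr.
    have loc x y : `|x - p| < (r - cabs z) / 2 ->
      `|y - q| < (r - cabs z) / 2 -> cabs ((x +i* y)%C : C) < r.
      move=> x1 y1; have := cabs_lt_sum x1 y1.
      have := ler_sub_cabs ((x +i* y)%C : C) z.
      have -> : (x +i* y)%C - z = ((x - p) +i* (y - q))%C :> C by [].
      lra.
    have d20 : 0 < (r - cabs z) / 2 by rewrite divr_gt0// subr_gt0; exact: zr.
    exists (complex.Re (A + B z)), (- complex.Im (A - B z)),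
      (- complex.Im (A + B z)), (- complex.Re (A - B z)).
    split.
    + apply: (diff2_ext d20 _ (diff2_Re hA)).
      by move=> x y x1 y1; rewrite /F1 /v loc.
    (* Since - Im u = Re (i u), the partial derivatives of [F2] come from those of the real part of
       i u. *)
    + have := diff2_Re (wdiffZ 'i%C hA).
      rewrite -mulrDr -mulrBr (mulrC 'i%C) ReiNIm (mulrC 'i%C) ImiRe => hA'.
      apply: (diff2_ext d20 _ hA') => x y x1 y1.
      by rewrite mulrC ReiNIm /F2 /v loc.
    + move=> e e0; have e2 : 0 < e / 2 by lra.
      have [d d0 hd] := ccont_Re (cB z zr) e2.
      exists (Num.min ((r - cabs z) / 2) (d / 2)).
        by rewrite lt_min !divr_gt0// subr_gt0; exact: zr.
      move=> x y; rewrite !lt_min => /andP[x1 x2] /andP[y1 y2].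
      rewrite /D patchE ifT; last by rewrite inE; exact: loc.
      have wz : ((x - p) +i* (y - q))%C + z = plane (x, y) :> C.
        by congr (_ +i* _)%C; rewrite /= subrK.
      have := hd _ (cabs_lt_sum x2 y2); rewrite wz => h.
      rewrite !ReD ReN; move: h; rewrite !ltr_norml ler_norml; lra.
  - left; exists 0, 0, 0, 0.
    have loc x y : `|x - p| < (cabs z - r) / 2 ->
      `|y - q| < (cabs z - r) / 2 -> (cabs ((x +i* y)%C : C) < r) = false.
      move=> x1 y1; apply/negbTE; rewrite -leNgt; have := cabs_lt_sum x1 y1.
      have := ler_sub_cabs z ((x +i* y)%C : C); rewrite cabs_sub.
      have -> : (x +i* y)%C - z = ((x - p) +i* (y - q))%C :> C by [].
      lra.
    have d20 : 0 < (cabs z - r) / 2 by rewrite divr_gt0// subr_gt0; exact: zr.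
    split.
    + move=> e e0; exists ((cabs z - r) / 2) => // x y x1 y1.
      rewrite /F1 /v !loc ?subrr ?normr0//= !mul0r !subr0 normr0.
      by rewrite mulr_ge0 ?addr_ge0// ltW.
    + move=> e e0; exists ((cabs z - r) / 2) => // x y x1 y1.
      rewrite /F2 /v !loc ?subrr ?normr0//= !mul0r !subr0 normr0.
      by rewrite mulr_ge0 ?addr_ge0// ltW.
    + move=> e e0; exists ((cabs z - r) / 2) => // x y x1 y1.
      rewrite /D patchE ifF; first by rewrite addr0 subr0 normr0 ltW.
      by apply/negP; rewrite inE /pball /= loc.
  (* A square of side h containing z stays within 2 h < eps of z, hence in the annulus. There |v| <=
     2 K h, so the increments across the square are at most 4 K h. *)
  - right; exists (eps / 2); first by lra.
    move=> x y h /andP[h0 he] xp yq.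
    have sq s t : x <= s <= x + h -> y <= t <= y + h ->
      cabs ((s +i* t)%C - z) <= 2 * h.
      move=> sx ty; apply: le_trans (ler_cabs_ReIm _) _;
        rewrite ReD ReN ImD ImN /=.
      have : `|s - p| <= h by rewrite ler_norml; lra.
      have : `|t - q| <= h by rewrite ler_norml; lra.
      lra.
    have vs s t : x <= s <= x + h -> y <= t <= y + h ->
      cabs (v (s +i* t)%C) <= 2 * K * h.
      move=> sx ty; have := vK z ((s +i* t)%C - z) ltac:(by rewrite zr).
      rewrite subrK => h1; apply: le_trans h1 _.
      by have := sq s t sx ty; nra.
    have fl : `|flux F1 F2 x y h| <= 8 * K * (h * h).
      have hh : 8 * K * (h * h) = (4 * K) * h * h *+ 2 by rewrite mulr2n; ring.
      rewrite -[flux _ _ _ _ _]subr0 -(mul0r (h * h)) -[X in X * (h * h)](addr0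
        0) hh.
      apply: flux_approx => //; first exact: ltW.
        move=> t ty; rewrite mul0r subr0 /F1.
        have := ler_Re_cabs (v ((x + h)%R +i* t)%C);
          have := ler_Re_cabs (v (x +i* t)%C).
        have := vs (x + h) t ltac:(lra) ty; have := vs x t ltac:(lra) ty.
        rewrite !ler_norml; lra.
      move=> t tx; rewrite mul0r subr0 /F2.
      have := ler_Im_cabs (v (t +i* (y + h)%R)%C);
        have := ler_Im_cabs (v (t +i* y)%C).
      have := vs t (y + h) tx ltac:(lra); have := vs t y tx ltac:(lra).
      rewrite !ler_norml; lra.
    have fD :
        `|Rintegral (area R) (rect x (x + h) y (y + h)) D| <= 2 * K * (h * h).
      have fe : fine (area R (rect x (x + h) y (y + h))) = h * h.
        by rewrite area_square// ltW.
      rewrite -fe -[Rintegral _ _ _]subr0 -[X in _ - X](mul0r (fine (area R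
        (rect x (x + h) y (y + h))))).
      apply: Rintegral_approx.
      + exact: measurable_rect.
      + by rewrite area_square ?ltry// ltW.
      + by apply: (integrableS _ _ _ iD) => //; exact: measurable_rect.
      + by move=> s _; rewrite subr0.
    split; last by apply: le_trans (ler_normB _ _) _; lra.
    move=> [s t]; rewrite /rect /= !in_itv /= => -[/andP[s1 s2] /andP[t1 t2]].
    have := sq s t ltac:(by rewrite (ltW s1)) ltac:(by rewrite (ltW t1)).
    suff : cabs ((s +i* t)%C - z) <= 2 * h ->
      `|cabs ((s +i* t)%C : C) - cabs z| < eps.
      by rewrite zr.
    have := ler_sub_cabs ((s +i* t)%C : C) z;
      have := ler_sub_cabs z ((s +i* t)%C : C).
    by rewrite (cabs_sub z); rewrite ltr_norml; lra.
have v0 x y : 1 <= cabs ((x +i* y)%C : C) -> v (x +i* y)%C = 0.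
  by move=> h; rewrite /v ifF//; apply/negbTE; rewrite -leNgt; lra.
have big x y : `|x| = 1 \/ `|y| = 1 -> v (x +i* y)%C = 0.
  move=> h; apply: v0; have := ler_Re_cabs ((x +i* y)%C : C).
  by have := ler_Im_cabs ((x +i* y)%C : C) => /=; case: h => ->.
have fl0 : flux F1 F2 (-1) (-1) 2 = 0.
  have n1 : `|(-1 : R)| = 1 by rewrite normrN1.
  have n2 : `|(-1 + 2 : R)| = 1 by rewrite ger0_norm; lra.
  have : `|flux F1 F2 (-1) (-1) 2 - (0 + 0) * (2 * 2)| <= 0 * 2 * 2 *+ 2.
    apply: flux_approx => // t _.
      by rewrite /F1 !big ?subrr ?mul0r ?subr0 ?normr0//; left.
    by rewrite /F2 !big ?subrr ?mul0r ?subr0 ?normr0//; right.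
  by rewrite addr0 !mul0r subr0 mul0rn normr_le0 => /eqP.
move: main; rewrite fl0 /D -Rintegral_mkcondr.
have -> : rect (-1) (-1 + 2) (-1) (-1 + 2) `&` pball r = pball r.
  apply/setIidr; have -> : (-1 + 2 : R) = 1 by ring.
  exact: pball_rect (ltW r1).
rewrite RintegralZl//; last 2 first.
- exact: measurable_pball.
- apply: (@integrable_pball R r (fun z => complex.Re (B z)) K (ltW r1)).
    by move=> z /cB; exact: ccont_Re.
  by move=> z /bB; apply: le_trans (ler_Re_cabs _).
by move/esym/eqP; rewrite mulf_eq0 pnatr_eq0 /= => /eqP.
Qed.

End Stokes.

(** * Moments of analytic functions over disks *)

Section Moments.
Variable R : realType.
Local Notation C := (Cx R).

Lemma ccontP (u : C -> C) z : ccont u z <-> u x @[x --> z] --> u z.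
Proof.
apply: (iff_trans _ (iff_sym (cvgCP (F := nbhs z) u (u z)))); split => h e e0.
  have [d d0 hd] := h e e0; apply/nbhs_ballP; exists ((d%:C)%C);
    first by rewrite /= ltcR.
  move=> x; rewrite -ball_normE /= distrC cabsE ltcR => xd.
  by have := hd (x - z) xd; rewrite subrK cabs_sub.
have := h e e0 => /nbhs_ballP [_ /= /gtC0P [d d0 ->] hd].
exists d => // w wd; rewrite cabs_sub; apply: hd.
by rewrite -ball_normE /= opprD addrCA subrr addr0 normrN cabsE ltcR.
Qed.

Lemma ccontM (u v : C -> C) z : ccont u z -> ccont v z ->
  ccont (fun x => u x * v x) z.
Proof. by move=> /ccontP hu /ccontP hv; apply/ccontP; exact: (cvgM hu hv). Qed.

Lemma ccontD (u v : C -> C) z : ccont u z -> ccont v z ->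
  ccont (fun x => u x + v x) z.
Proof. by move=> /ccontP hu /ccontP hv; apply/ccontP; exact: (cvgD hu hv). Qed.

Lemma ccontB (u v : C -> C) z : ccont u z -> ccont v z ->
  ccont (fun x => u x - v x) z.
Proof. by move=> /ccontP hu /ccontP hv; apply/ccontP; exact: (cvgB hu hv). Qed.

Lemma ccont_cst (c : C) z : ccont (fun=> c) z.
Proof. by move=> e e0; exists 1 => // w _; rewrite subrr cabs0. Qed.

Lemma ccont_id z : ccont (fun x : C => x) z.
Proof. by move=> e e0; exists e => // w we; rewrite addrK. Qed.

Lemma ccontX (n : nat) z : ccont (fun x : C => x ^+ n) z.
Proof.
elim: n => [|n IH].
  by rewrite (_ : (fun x : C => x ^+ 0) = cst 1)//; exact: ccont_cst.
rewrite (_ : (fun x : C => x ^+ n.+1) = fun x => x * x ^+ n);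
  last by apply/funext => x; rewrite exprS.
by apply: ccontM => //; exact: ccont_id.
Qed.

Lemma ccont_conj (u : C -> C) z : ccont u z -> ccont (fun x => (u x)^*) z.
Proof.
move=> h e e0; have [d d0 hd] := h e e0; exists d => // w /hd.
by rewrite -rmorphB cabs_conj.
Qed.

Lemma cdiffM (u v : C -> C) z A B : cdiff u z A -> cdiff v z B ->
  cdiff (fun x => u x * v x) z (A * v z + u z * B).
Proof.
move=> /cdiffP hu /cdiffP hv; apply/cdiffP.
have h := is_deriveM hu hv; rewrite (_ : A * v z + u z * B = u z *: B +
  v z *: A); first exact: h.
by rewrite /GRing.scale /= addrC (mulrC (v z)).
Qed.

Lemma cdiffD (u v : C -> C) z A B : cdiff u z A -> cdiff v z B ->
  cdiff (fun x => u x + v x) z (A + B).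
Proof. by move=> /cdiffP hu /cdiffP hv; apply/cdiffP; exact: is_deriveD. Qed.

Lemma cdiff_cst (c : C) z : cdiff (fun=> c) z 0.
Proof. by apply/cdiffP; exact: is_derive_cst. Qed.

Lemma cdiff_id z : cdiff (fun x : C => x) z 1.
Proof. by apply/cdiffP; exact: is_derive_id. Qed.

Lemma cdiffX n z : exists A, cdiff (fun x : C => x ^+ n) z A.
Proof.
elim: n => [|n [A IH]].
  by exists 0; rewrite (_ : (fun x : C => x ^+ 0) = cst 1)//; exact: cdiff_cst.
exists (1 * z ^+ n + z * A).
rewrite (_ : (fun x : C => x ^+ n.+1) = fun x => x * x ^+ n);
  last by apply/funext => x; rewrite exprS.
by apply: cdiffM => //; exact: cdiff_id.
Qed.

Lemma cdiffZ (c : C) (u : C -> C) z A : cdiff u z A ->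
  cdiff (fun x => c * u x) z (c * A).
Proof.
by move=> /(cdiffM (cdiff_cst c z)); rewrite mul0r add0r.
Qed.

Lemma cdiff_sum (I : Type) (s : seq I) (F : I -> C -> C) z :
  (forall i, exists A, cdiff (F i) z A) ->
    exists A, cdiff (fun x => \sum_(i <- s) F i x) z A.
Proof.
move=> h; elim: s => [|i s [A IH]].
  by exists 0; rewrite (_ : (fun x => _) = fun=> 0);
    [exact: cdiff_cst | apply/funext => x; rewrite big_nil].
have [B hB] := h i; exists (B + A).
rewrite (_ : (fun x => _) = fun x => F i x + \sum_(j <- s) F j x);
  first exact: cdiffD.
by apply/funext => x; rewrite big_cons.
Qed.

(** The Lipschitz constant of the n-th power on [0, 1]; it gives the linear decay of w Phi at the
    circle. *)
Lemma subrXX_le (x y : R) n : 0 <= x -> x <= y -> y <= 1 ->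
  `|x ^+ n - y ^+ n| <= n%:R * (y - x).
Proof.
move=> x0 xy y1; rewrite distrC ger0_norm; last by rewrite subr_ge0 lerXn.
elim: n => [|n IH]; first by rewrite subrr mul0r.
have -> : y ^+ n.+1 - x ^+ n.+1 = y * (y ^+ n - x ^+ n) + (y - x) * x ^+ n.
  by rewrite !exprS; ring.
have xn : x ^+ n <= 1 by apply: exprn_ile1 => //; exact: le_trans xy y1.
have xn0 : 0 <= x ^+ n by exact: exprn_ge0.
have yx : x ^+ n <= y ^+ n by exact: lerXn.
rewrite -natr1; nra.
Qed.

(** Taylor coefficients of the primitive vanishing at 0. *)
Definition int_coef (d : nat -> C) k : C :=
  if k is j.+1 then d j / j.+1%:R else 0.

(* The Taylor coefficients of the projection of conj(z)^m g. *)
Definition proj_coef m (d : nat ->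
  C) k : C := k.+1%:R / (m + k.+1)%:R * d (m + k)%N.

Lemma natC_neq0 n : n.+1%:R != 0 :> C.
Proof. by rewrite pnatr_eq0. Qed.

Lemma dcoef_int_coef d : dcoef (int_coef d) = d.
Proof. by apply/funext => k; rewrite /dcoef /= mulrC divfK// natC_neq0. Qed.

Lemma subexp_int_coef d : subexp d -> subexp (int_coef d).
Proof.
move=> hd r r01; have [M hM] := hd r r01; have /andP[r0 r1] := r01.
have M0 : 0 <= M by apply: le_trans (hM 0%N); rewrite expr0 mulr1.
exists M => -[|k]; rewrite /int_coef; first by rewrite cabs0 mul0r.
apply: le_trans (hM k); rewrite cabsM cabsV cabs_nat exprS.
have := cabs_ge0 (d k); have : 0 <= r ^+ k by exact: exprn_ge0.
move=> rk dk; have k1 : r / k.+1%:R <= 1.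
  by rewrite ler_pdivrMr ?ltr0n// mul1r; apply: le_trans (ltW r1) _;
    rewrite ler1n.
have -> : cabs (d k) / k.+1%:R * (r * r ^+ k) = r / k.+1%:R * (cabs (d k) * r ^+
  k) by ring.
by apply: ler_piMl => //; exact: mulr_ge0.
Qed.

Lemma subexp_proj_coef m d : subexp d -> subexp (proj_coef m d).
Proof.
move=> /(subexp_shift m); apply: le_subexp => k; rewrite /proj_coef cabsM.
rewrite -[leRHS]mul1r ler_wpM2r// cabsM cabsV !cabs_nat.
by rewrite addnS ler_pdivrMr ?ltr0n// mul1r ler_nat ltnS leq_addl.
Qed.

(** The terms of degree above m in the primitive of g are z^m times those of the primitive of G.
    After conjugation this turns each term of Phi into a multiple of |z|^(2n) - r^(2n) for some
    n. *)
Lemma int_coef_split m (d : nat -> C) (gg GG : C -> C) :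
  power_series (int_coef d) gg ->
  power_series (fun k => if k is j.+1 then d (m + j)%N / (m +
    j).+1%:R else 0) GG ->
  forall z, disk R z -> gg z = z ^+ m * GG z +
    \sum_(k < m) d k / k.+1%:R * z ^+ k.+1.
Proof.
move=> hgg hGG; pose GGc k : C := if k is j.+1 then d (m + j)%N / (m +
  j).+1%:R else 0.
have hp := power_seriesD (@power_seriesXn _ m _ _ hGG) (@power_series_poly _
  m.+1 (int_coef d)).
have hs z : \sum_(k < m.+1) int_coef d k * z ^+ k = \sum_(k < m) d k / k.+1%:R *
  z ^+ k.+1.
  by rewrite big_ord_recl /= mul0r add0r; apply: eq_bigr => i _.
move=> z zd; rewrite -hs; apply: (@power_series_uniq _ _ gg (fun z =>
  z ^+ m * GG z +
  \sum_(k < m.+1) int_coef d k * z ^+ k) hgg _ z zd).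
rewrite [X in power_series X](_ : _ = (fun k =>
  (if (m <= k)%N then GGc (k - m)%N else 0) +
   (if (k < m.+1)%N then int_coef d k else 0))); first exact: hp.
apply/funext => k; rewrite ltnS.
have [mk|km] := leqP m k; last by rewrite ltnW// add0r.
(* At k = m both conditions hold, but nothing is counted twice: the coefficient of index 0 of [GGc]
   is 0. *)
have [km|km] := leqP k m.
  have -> : k = m by apply/eqP; rewrite eqn_leq km.
  by rewrite subnn add0r.
rewrite addr0; case: k mk km => // k _; rewrite ltnS => mk /=.
by rewrite subSn//= subnKC.
Qed.

Lemma moment_identity (m : nat) (d : nat -> C) (g G w : C ->
  C) (r : R) : 0 < r < 1 ->
  power_series d g -> power_series (proj_coef m d) G -> analytic w ->
  Rintegral (area R) (pball r) (fun p => complex.Re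
    ((((plane p)^*) ^+ m * g (plane p) - ((r ^+ m.*2)%:C)%C * G (plane p)) * (w
      (plane p))^*)) = 0.
Proof.
move=> r01 hg hG aw; have /andP[r0 r1] := r01.
have [gg hgg] := subexp_power_series (subexp_int_coef (power_series_subexp hg)).
pose GGc k : C := if k is j.+1 then d (m + j)%N / (m + j).+1%:R else 0.
have dGG : dcoef GGc = proj_coef m d.
  by apply/funext => k; rewrite /dcoef /proj_coef /= addnS mulrCA mulrC mulrAC.
have sGG : subexp GGc.
  apply: le_subexp (subexp_int_coef (subexp_shift m (power_series_subexp hg)))
    => -[|k]; rewrite /int_coef /GGc //.
  rewrite !cabsM !cabsV !cabs_nat; apply: ler_wpM2l => //.
  by rewrite lef_pV2 ?posrE ?ltr0n// ler_nat ltnS leq_addl.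
have [GG hGG] := subexp_power_series sGG.
have dgg z : cabs z < 1 -> cdiff gg z (g z).
  move=> /diskE zd; apply: (power_series_cdiff hgg _ zd).
  by rewrite dcoef_int_coef.
have dGGz z : cabs z < 1 -> cdiff GG z (G z).
  by move=> /diskE zd; apply: (power_series_cdiff hGG _ zd); rewrite dGG.
pose rho : C := ((r ^+ m.*2)%:C)%C.
(* The polynomial part of Phi. Being analytic it does not contribute to [B]; it only makes Phi
   vanish on the circle. *)
pose P z : C := \sum_(k < m) (d k)^* * ((r ^+ (k.+1).*2)%:C)%C / k.+1%:R * z ^+
  (m - k.+1).
pose u z : C := w z * z ^+ m * (gg z)^* + (- rho) * (w z * (GG z)^*) +
  (- 1) * (w z * P z).
pose B z : C := w z * z ^+ m * (g z)^* - rho * (w z * (G z)^*).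
have lt1 z : cabs z < r -> cabs z < 1 by move=> h; exact: lt_trans r1.
have cg z : cabs z < 1 -> ccont g z by move=> z1; apply: analytic_ccont z1;
  exact: (power_series_analytic hg).
have cG z : cabs z < 1 -> ccont G z by move=> z1; apply: analytic_ccont z1;
  exact: (power_series_analytic hG).
have cw z : cabs z < 1 -> ccont w z by move=> z1; apply: analytic_ccont z1.
have cGG z : cabs z < 1 -> ccont GG z by move=> z1; apply: analytic_ccont z1;
  exact: (power_series_analytic hGG).
have cB z : cabs z < 1 -> ccont B z.
  move=> z1; apply: ccontB; apply: ccontM.
  - by apply: ccontM; [exact: cw|exact: ccontX].
  - by apply: ccont_conj; exact: cg.
  - exact: ccont_cst.
  - by apply: ccontM; [exact: cw|apply: ccont_conj; exact: cG].
have [K1 [K10 hK1]] := bounded_pball r1 cB.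
have [K2 [K20 hK2]] := bounded_pball r1 cw.
have [K3 [K30 hK3]] := bounded_pball r1 cGG.
have du z : cabs z < r -> exists A, wdiff u z A (B z).
  move=> zr; have z1 := lt1 z zr; have dw := analyticP aw z1.
  have [X hX] := cdiffX m z.
  have [Y hY] : exists A, cdiff P z A.
    apply: cdiff_sum => i; have [Z hZ] := cdiffX (m - i.+1) z.
    by eexists; apply: cdiffZ hZ.
  have H1 := wdiff_mul_conj (cdiffM dw hX) (dgg z z1).
  have H2 := wdiffZ (- rho) (wdiff_mul_conj dw (dGGz z z1)).
  have H3 := wdiffZ (- 1) (cdiff_wdiff (cdiffM dw hY)).
  have -> : B z = w z * z ^+ m * (g z)^* + - rho * (w z * (G z)^*) + - 1 * 0.
    by rewrite /B; ring.
  by eexists; exact: (wdiffD (wdiffD H1 H2) H3).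
pose S := \sum_(k < m) cabs (d k).
have S0 : 0 <= S by apply: sumr_ge0.
have bu z : cabs z < r -> cabs (u z) <= K2 * (K3 * (m.*2)%:R +
  2 * S) * (r - cabs z).
  move=> zr; have z1 := lt1 z zr; have zd : disk R z by exact/diskE.
  have zz : z * z^* = ((cabs z ^+ 2)%:C)%C by rewrite sqr_cabsE.
  have zzn n : z ^+ n * (z^*) ^+ n = ((cabs z ^+ n.*2)%:C)%C.
    by rewrite -exprMn zz -rmorphXn -exprM mul2n.
  (* Every term now carries a factor |z|^(2n) - r^(2n), of modulus at most 2n (r - |z|). For n = k+1
     the denominator k+1 reduces this to the constant 2 in front of [S]. *)
  have -> : u z = w z * ((GG z)^* * (((cabs z ^+ m.*2)%:C)%C - rho) +
     \sum_(k < m) (d k)^* / k.+1%:R * z ^+ (m - k.+1) *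
        (((cabs z ^+ (k.+1).*2)%:C)%C - ((r ^+ (k.+1).*2)%:C)%C)).
    rewrite /u /P (int_coef_split hgg hGG zd) rmorphD rmorphM rmorphXn
      rmorph_sum -zzn.
    rewrite -[LHS]addrA; under [X in _ = w z * (_ +
      X)]eq_bigr do rewrite mulrBr.
    rewrite sumrB.
    have -> : \sum_(k < m) (d k)^* / k.+1%:R * z ^+ (m - k.+1) * ((cabs z ^+
      k.+1.*2)%:C)%C =
       z ^+ m * \sum_(k < m) (d k / k.+1%:R * z ^+ k.+1)^*.
      rewrite mulr_sumr; apply: eq_bigr => k _.
      rewrite -zzn !rmorphM rmorphXn fmorphV rmorph_nat.
      have -> : z ^+ m = z ^+ (m - k.+1) * z ^+ k.+1 by rewrite -exprD subnK.
      by ring.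
    have -> : \sum_(k < m) (d k)^* / k.+1%:R * z ^+ (m - k.+1) * ((r ^+
      k.+1.*2)%:C)%C =
       \sum_(k < m) (d k)^* * ((r ^+ (k.+1).*2)%:C)%C / k.+1%:R * z ^+ (m -
         k.+1).
      by apply: eq_bigr => k _; ring.
    by ring.
  have pd n : cabs (((cabs z ^+ n)%:C)%C - ((r ^+ n)%:C)%C) <=
    n%:R * (r - cabs z).
    by rewrite -rmorphB cabs_real subrXX_le// ltW.
  have rz : 0 <= r - cabs z by lra.
  rewrite cabsM -[X in _ <= X]mulrA; apply: ler_pM => //;
    first exact: hK2 (ltW zr).
  apply: le_trans (ler_cabsD _ _) _; rewrite mulrDl; apply: lerD.
    by rewrite cabsM cabs_conj -[X in _ <= X]mulrA; apply: ler_pM => //;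
      exact: hK3 (ltW zr).
  apply: le_trans (ler_cabs_sum _ _ _) _; rewrite /S mulr_sumr mulr_suml.
  apply: ler_sum => k _; rewrite !cabsM cabsV cabs_nat cabs_conj cabsX.
  have z01 : cabs z ^+ (m - k.+1) <=
    1 by exact (exprn_ile1 _ (cabs_ge0 z) (ltW z1)).
  have z00 : 0 <= cabs z ^+ (m - k.+1) by exact: exprn_ge0.
  apply: le_trans (_ : cabs (d k) / k.+1%:R * 1 * ((k.+1).*2%:R * (r - cabs z))
    <= _).
    have dk : 0 <= cabs (d k) / k.+1%:R by rewrite divr_ge0.
    by apply: ler_pM => //; [exact: mulr_ge0 | exact: ler_wpM2l].
  rewrite le_eqVlt; apply/orP; left; apply/eqP; rewrite -mul2n natrM.
  have : k.+1%:R != 0 :> R by rewrite pnatr_eq0.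
  by move: (k.+1%:R : R) (cabs (d k)) => a b a0; field.
pose K := K1 + K2 * (K3 * (m.*2)%:R + 2 * S).
have T0 : 0 <= K2 * (K3 * (m.*2)%:R +
  2 * S) by rewrite mulr_ge0// addr_ge0// mulr_ge0.
(* The integrand of the statement is the conjugate of [B], which has the same real part. *)
rewrite -(@stokes_disk_Re R u B r K r01).
- apply: eq_Rintegral => p _; rewrite /B; set z := plane p.
  have E x y : complex.Re (x * y) = complex.Re (x^* * y^* : C).
    by rewrite -rmorphM cRe_conj.
  have rhoJ : rho^* = rho by exact: conjc_real.
  rewrite -/rho E; congr (complex.Re _).
  move: rhoJ; move: (rho) => s sJ.
  by rewrite rmorphB !rmorphM rmorphXn /= !conjCK sJ; ring.
- by rewrite addr_ge0.
- exact: du.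
- by move=> z /lt1; exact: cB.
- by move=> z zr; apply: le_trans (hK1 z (ltW zr)) _; rewrite lerDl.
- move=> z zr; apply: le_trans (bu z zr) _.
  by rewrite ler_wpM2r ?subr_ge0 ?(ltW zr)// lerDr.
Qed.

End Moments.

(** * The Bergman space *)

Section Bergman.
Variable R : realType.
Local Notation C := (Cx R).
Local Notation plane_type := (measurableTypeR R * measurableTypeR R)%type.

(** Transfers the vanishing of an integral to the normalized measure. Scaling is applied to the
    positive and negative parts, as it is available for nonnegative functions. *)
Lemma Rintegral_dA_eq0 (D : set plane_type) (f : plane_type ->
  R) : measurable D ->
  (area R).-integrable D (EFin \o f) -> Rintegral (area R) D f = 0 ->
  Rintegral (dA R) D f = 0.
Proof.
move=> mD iF; rewrite /Rintegral.
have mf : measurable_fun D (fun x => (f x)%:E) by case/integrableP: iF.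
have fp := integrable_pos_fin_num mD iF.
have fn := integrable_neg_fin_num mD iF.
have S (k : plane_type -> \bar R) : measurable_fun D k -> (forall x, D x ->
  (0 <= k x)%E) ->
    (\int[dA R]_(x in D) k x = (1 / pi)%:E * \int[area R]_(x in D) k x)%E.
  exact: ge0_integral_mscale.
rewrite [integral (area R) _ _]integralE [integral (dA R) _ _]integralE.
rewrite (S _ (measurable_funepos mf)); last by move=> x _; exact: funepos_ge0.
rewrite (S _ (measurable_funeneg mf)); last by move=> x _; exact: funeneg_ge0.
move: fp fn => /fineK <- /fineK <-; rewrite -!EFinM -!EFinB /= => h.
by rewrite -mulrBr h mulr0.
Qed.

Definition disk_continuous (u : C -> C) := forall z, cabs z < 1 -> ccont u z.

Lemma disk_continuous_measurable u : disk_continuous u -> disk_measurable u.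
Proof.
move=> cu; rewrite /disk_measurable plane_diskE; split.
  apply: (@measurable_fun_plane R _ (fun z =>
    complex.Re (u z)) (@disk_open_ball R 1)).
  by move=> z /cu; exact: ccont_Re.
apply: (@measurable_fun_plane R _ (fun z =>
  complex.Im (u z)) (@disk_open_ball R 1)).
by move=> z /cu; exact: ccont_Im.
Qed.

Lemma Re_cabsX2 (z : C) : complex.Re (`|z| ^+ 2) = cabs z ^+ 2.
Proof. by rewrite cabsE -rmorphXn. Qed.

Lemma measurable_cabs2 u (r : R) : r <= 1 -> disk_continuous u ->
  measurable_fun (pball r) (fun p => cabs (u (plane p)) ^+ 2).
Proof.
move=> r1 cu.
apply: (@measurable_fun_plane R _ (fun z =>
  cabs (u z) ^+ 2) (@disk_open_ball R r)).
have E z : cabs (u z) ^+ 2 = complex.Re (u z * (u z)^*) by rewrite -sqr_cabsE.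
move=> z zr e e0; have z1 : cabs z < 1 by apply: lt_le_trans r1.
have [d d0 hd] := ccont_Re (ccontM (cu z z1) (ccont_conj (cu z z1))) e0.
by exists d => // w /hd; rewrite !E.
Qed.

Lemma L2_diskP u : disk_continuous u ->
  L2_disk u <-> (dA R).-integrable (pball 1) (fun p =>
    (cabs (u (plane p)) ^+ 2)%:E).
Proof.
move=> cu; have mu := measurable_cabs2 (lexx 1) cu.
have E : (\int[dA R]_(p in plane_disk R) (complex.Re (`|u (plane p)| ^+
  2))%:E)%E =
         (\int[dA R]_(p in pball 1) `|(cabs (u (plane p)) ^+ 2)%:E|)%E.
  rewrite plane_diskE; apply: eq_integral => p _.
  by rewrite Re_cabsX2 /= ger0_norm// sqr_ge0.
rewrite /L2_disk E; split => [[_ h]|/integrableP[_ h]].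
  by apply/integrableP; split => //; exact/measurable_EFinP.
by split => //; exact: disk_continuous_measurable.
Qed.

Lemma L2_le (u v w : C -> C) (K : R) : disk_continuous u ->
  disk_continuous v -> disk_continuous w ->
  (forall z, cabs z < 1 -> cabs (u z) ^+ 2 <= K * (cabs (v z) ^+ 2 +
    cabs (w z) ^+ 2)) ->
  L2_disk v -> L2_disk w -> L2_disk u.
Proof.
move=> cu cv cw h /(L2_diskP cv) iv /(L2_diskP cw) iw; apply/(L2_diskP cu).
have mp := measurable_pball (1 : R).
apply: (le_integrable mp _ _ (integrableZl mp K (integrableD mp iv iw))).
  by apply/measurable_EFinP; apply: measurable_cabs2.
move=> p p1 /=; rewrite lee_fin ger0_norm ?sqr_ge0//.
by apply: le_trans (h _ p1) _; rewrite ler_norm.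
Qed.

Lemma integrable_L2M (u v : C -> C) : disk_continuous u ->
  disk_continuous v -> L2_disk u -> L2_disk v ->
  (dA R).-integrable (pball 1) (fun p =>
    (complex.Re (u (plane p) * (v (plane p))^*))%:E).
Proof.
move=> cu cv /(L2_diskP cu) iu /(L2_diskP cv) iv.
have mp := measurable_pball (1 : R).
apply: (le_integrable mp _ _ (integrableD mp iu iv)).
  apply/measurable_EFinP.
  apply: (@measurable_fun_plane R _ (fun z =>
    complex.Re (u z * (v z)^*)) (@disk_open_ball R 1)).
  by move=> z z1; apply: (@ccont_Re _ (fun z => u z * (v z)^*)); apply: ccontM;
    [exact: cu|apply: ccont_conj; exact: cv].
move=> p p1 /=; rewrite lee_fin [leRHS]ger0_norm ?addr_ge0 ?sqr_ge0//.
apply: le_trans (ler_Re_cabs _) _; rewrite cabsM cabs_conj.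
have := sqr_ge0 (cabs (u (plane p)) - cabs (v (plane p))).
by have := sqr_ge0 (cabs (u (plane p)) + cabs (v (plane p))); nra.
Qed.

(** Radii increasing to 1. The index shift keeps them at least 1/2, so that r^(2m) stays away from
    0. *)
Definition inner_radius n : R := 1 - n.+2%:R^-1.

Lemma inner_radius_lt n : 2^-1 <= inner_radius n < 1.
Proof.
rewrite /inner_radius; have h : 0 < n.+2%:R^-1 :> R by rewrite invr_gt0 ltr0n.
have : n.+2%:R^-1 <= 2^-1 :> R by rewrite lef_pV2 ?posrE ?ltr0n// ler_nat.
by move: (n.+2%:R^-1 : R) h => x h1 h2; lra.
Qed.

Lemma inner_radius_01 n : 0 < inner_radius n < 1.
Proof. by have /andP[h ->] := inner_radius_lt n; rewrite andbT;
  apply: lt_le_trans h; rewrite invr_gt0. Qed.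

Lemma inner_radius_homo m n : (m <= n)%N -> inner_radius m <= inner_radius n.
Proof.
by move=> mn; rewrite /inner_radius lerB// lef_pV2 ?posrE ?ltr0n// ler_nat
  !ltnS.
Qed.

Lemma inner_radius_cvg : inner_radius n @[n --> \oo] --> (1 : R).
Proof.
rewrite -[X in _ --> X](subr0 1); apply: cvgB; first exact: cvg_cst.
have := @cvg_harmonic R; rewrite -(cvg_shiftS (@harmonic R)).
by [].
Qed.

Lemma inner_radius_gt (x : R) : x < 1 -> exists N, forall n, (N <= n)%N ->
  x < inner_radius n.
Proof.
move=> x1; have e0 : 0 < 1 - x by lra.
have := inner_radius_cvg => /cvgrPdist_lt /(_ _ e0) [N _ hN].
exists N => n Nn; have := hN n Nn; have /andP[_ r1] := inner_radius_lt n.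
by rewrite ger0_norm; lra.
Qed.

Lemma pball_inner_radius_sub n : pball (inner_radius n) `<=` pball 1.
Proof.
move=> p; rewrite /pball /= => h; apply: lt_trans h _;
  by case/andP: (inner_radius_lt n).
Qed.

(** Dominated convergence with dominating function |F|: at each point of the disk the restrictions
    of F are eventually constant. *)
Lemma Rintegral_pball_cvg (F : plane_type -> R) :
  (dA R).-integrable (pball 1) (EFin \o F) ->
  Rintegral (dA R) (pball (inner_radius n)) F @[n --> \oo] --> Rintegral (dA R)
    (pball 1) F.
Proof.
move=> iF.
have mF : measurable_fun (pball 1) (EFin \o F) by case/integrableP: iF.
have mp := measurable_pball (1 : R).
pose fn n := (EFin \o F) \_ (pball (inner_radius n)).
have E n : (\int[dA R]_(x in pball 1) fn n x = \int[dA R]_(x in pball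
  (inner_radius n)) (F x)%:E)%E.
  rewrite /fn -integral_mkcondr; congr (integral _ _ _).
  by apply/setIidr; exact: pball_inner_radius_sub.
have [] := @dominated_convergence _ _ _ (dA R) _ mp fn (EFin \o F) (abse \o
  (EFin \o F)).
- move=> n; rewrite /fn.
  have mr : measurable (pball (inner_radius n)) by exact: measurable_pball.
  apply/(measurable_restrict (EFin \o F) mr mp).
  by apply: (measurable_funS mp _ mF); exact: subIsetl.
- exact: mF.
- apply: aeW => p p1; rewrite /fn.
  have [N hN] := inner_radius_gt p1.
  apply: cvg_near_cst; exists N => // n /= Nn.
  by rewrite patchE ifT// inE; exact: hN.
- exact: integrable_abse.
- apply: aeW => p n _; rewrite /fn patchE; case: ifP => _ //=.
  by rewrite normr0 lee_fin.
move=> _ _ h; have f1 := integrable_fin_num mp iF.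
rewrite /Rintegral; apply: fine_cvg.
rewrite fineK//; move: h; under eq_fun do rewrite E; exact.
Qed.

Lemma dA_pball_lty (r : R) : r <= 1 -> (dA R (pball r) < +oo)%E.
Proof.
move=> r1; rewrite [ltLHS](_ : _ = (1 / pi)%:E * area R (pball r))%E//.
apply: lte_mul_pinfty => //; last exact: area_pball_lty.
by rewrite lee_fin divr_ge0// pi_ge0.
Qed.

Lemma dA_integrable_pball (r : R) (u : C -> C) : r < 1 -> disk_continuous u ->
  (dA R).-integrable (pball r) (fun p => (complex.Re (u (plane p)))%:E) /\
  (area R).-integrable (pball r) (fun p => (complex.Re (u (plane p)))%:E).
Proof.
move=> r1 cu; have [K [K0 hK]] := bounded_pball r1 cu.
have cr z : cabs z < r -> forall e : R, 0 < e ->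
     exists2 d : R, 0 < d & forall w, cabs w < d ->
       `|complex.Re (u (w + z)) - complex.Re (u z)| < e.
  by move=> zr; apply: ccont_Re; apply: cu; exact: lt_trans r1.
have br z : cabs z < r -> `|complex.Re (u z)| <= K.
  by move=> zr; apply: le_trans (ler_Re_cabs _) (hK z (ltW zr)).
split; last exact: (@integrable_pball R r (fun z =>
  complex.Re (u z)) K (ltW r1) cr br).
apply: measurable_bounded_integrable.
- exact: measurable_pball.
- exact: dA_pball_lty (ltW r1).
- exact: (@measurable_fun_plane R _ (fun z =>
  complex.Re (u z)) (@disk_open_ball R r) cr).
- exists K; split; first exact: num_real.
  by move=> M KM p pr; apply: le_trans (ltW KM); exact: br.
Qed.

Lemma disk_continuousM u v : disk_continuous u -> disk_continuous v ->
  disk_continuous (fun z => u z * v z).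
Proof. by move=> cu cv z z1; apply: ccontM; [exact: cu|exact: cv]. Qed.

Lemma disk_continuousB u v : disk_continuous u -> disk_continuous v ->
  disk_continuous (fun z => u z - v z).
Proof. by move=> cu cv z z1; apply: ccontB; [exact: cu|exact: cv]. Qed.

Lemma disk_continuousD u v : disk_continuous u -> disk_continuous v ->
  disk_continuous (fun z => u z + v z).
Proof. by move=> cu cv z z1; apply: ccontD; [exact: cu|exact: cv]. Qed.

Lemma disk_continuous_conj u : disk_continuous u ->
  disk_continuous (fun z => (u z)^*).
Proof. by move=> cu z z1; apply: ccont_conj; exact: cu. Qed.

Lemma disk_continuous_conjX m : disk_continuous (fun z => (z^*) ^+ m).
Proof.
move=> z z1; rewrite (_ : (fun z : C => (z^*) ^+ m) = fun z => (z ^+ m)^*);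
  last first.
  by apply/funext => x; rewrite rmorphXn.
by apply: ccont_conj; exact: ccontX.
Qed.

Lemma disk_continuous_cst c : disk_continuous (fun=> c).
Proof. by move=> z _; exact: ccont_cst. Qed.

Lemma analytic_disk_continuous u : analytic u -> disk_continuous u.
Proof. by move=> au z z1; apply: analytic_ccont z1. Qed.

(** Below radius 1 all the integrands are bounded, so the difference in [moment_identity] splits
    without any L2 hypothesis, in particular before G is known to be in L2. *)
Lemma moment_identity_dA m d (g G w : C -> C) n :
  power_series d g -> power_series (proj_coef m d) G -> analytic w ->
  Rintegral (dA R) (pball (inner_radius n)) (fun p => complex.Re
      (((plane p)^*) ^+ m * g (plane p) * (w (plane p))^*)) =
  inner_radius n ^+ m.*2 * Rintegral (dA R) (pball (inner_radius n)) (fun p =>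
    complex.Re
      (G (plane p) * (w (plane p))^*)).
Proof.
move=> hg hG aw; have r01 := inner_radius_01 n; have /andP[r0 r1] := r01.
move: (inner_radius n) r01 r0 r1 => r r01 r0 r1.
have cg := analytic_disk_continuous (power_series_analytic hg).
have cG := analytic_disk_continuous (power_series_analytic hG).
have cw := disk_continuous_conj (analytic_disk_continuous aw).
have c1 := disk_continuousM (disk_continuousM (@disk_continuous_conjX m) cg) cw.
have c2 := disk_continuousM cG cw.
have mr := measurable_pball r.
rewrite -RintegralZl//; last exact: (dA_integrable_pball r1 c2).1.
apply/eqP; rewrite -subr_eq0 -RintegralB//; last 2 first.
- exact: (dA_integrable_pball r1 c1).1.
- have := integrableZl mr (r ^+ m.*2) (dA_integrable_pball r1 c2).1.
  by apply: eq_integrable => // p _.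
apply/eqP.
pose U z : C := ((z^*) ^+ m * g z - ((r ^+ m.*2)%:C)%C * G z) * (w z)^*.
have cU : disk_continuous U.
  by apply: disk_continuousM => //; apply: disk_continuousB;
    [exact: disk_continuousM (@disk_continuous_conjX m) cg | exact:
      disk_continuousM (@disk_continuous_cst _) cG].
have := Rintegral_dA_eq0 mr (dA_integrable_pball r1 cU).2 (moment_identity r01
  hg hG aw).
move=> <-; apply: eq_Rintegral => p _; rewrite /U.
move: ((_ ^* ) ^+ m * g _) (G _) ((w _)^*) => x y s.
by rewrite !cReM !ReD !ImD !ReN !ImN !cReM !cImM /=; ring.
Qed.

Lemma L2_conjX m u : disk_continuous u -> L2_disk u ->
  L2_disk (fun z => (z^*) ^+ m * u z).
Proof.
move=> cu lu; apply: (@L2_le _ u u 1 _ cu cu) => //.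
  by apply: disk_continuousM => //; exact: disk_continuous_conjX.
move=> z z1; rewrite mul1r cabsM cabsX cabs_conj exprMn.
apply: le_trans (_ : cabs (u z) ^+ 2 <= _); last by rewrite lerDl sqr_ge0.
rewrite ler_piMl ?sqr_ge0// -exprM; exact (exprn_ile1 _ (cabs_ge0 z) (ltW z1)).
Qed.

(* The identity on the disk of radius r < 1 with w := G bounds the L2 norm of G
   over that disk by a constant multiple of the norm of g. *)
Lemma proj_L2 m d (g G : C -> C) : power_series d g ->
  power_series (proj_coef m d) G ->
  L2_disk g -> L2_disk G.
Proof.
move=> hg hG lg.
have ag := power_series_analytic hg; have aG := power_series_analytic hG.
have cg := analytic_disk_continuous ag; have cG := analytic_disk_continuous aG.
have /(L2_diskP cg) ig := lg.
have mp := measurable_pball (1 : R).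
(* A lower bound for r^(2m) valid at all the radii used, since they are at least 1/2. *)
pose c : R := 2^-1 ^+ m.*2.
have c0 : 0 < c by rewrite exprn_gt0// invr_gt0.
pose M := Rintegral (dA R) (pball 1) (fun p => cabs (g (plane p)) ^+ 2).
have bound n : (\int[dA R]_(p in pball (inner_radius n)) (cabs (G (plane p)) ^+
  2)%:E <= (M / c ^+ 2)%:E)%E.
  have hs := moment_identity_dA n hg hG aG.
  have /andP[rn0 rn1] := inner_radius_lt n;
    move: hs rn0 rn1 (@pball_inner_radius_sub n).
  move: (inner_radius n) => r hs rn0 rn1 sub.
  have mr := measurable_pball r.
  have c1 := disk_continuousM (disk_continuousM (@disk_continuous_conjX m) cg)
    (disk_continuous_conj cG).
  have c2 := disk_continuousM cG (disk_continuous_conj cG).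
  have c3 := disk_continuousM cg (disk_continuous_conj cg).
  have i1 := (dA_integrable_pball rn1 c1).1.
  have i2 := (dA_integrable_pball rn1 c2).1.
  have i3 := (dA_integrable_pball rn1 c3).1.
  have E (u : C -> C) p : complex.Re (u p * (u p)^*) = cabs (u p) ^+ 2 by
    rewrite -sqr_cabsE.
  pose I1 := Rintegral (dA R) (pball r) (fun p =>
    complex.Re (((plane p)^*) ^+ m * g (plane p) * (G (plane p))^*)).
  pose I2 := Rintegral (dA R) (pball r) (fun p =>
    complex.Re (G (plane p) * (G (plane p))^*)).
  pose I3 := Rintegral (dA R) (pball r) (fun p =>
    complex.Re (g (plane p) * (g (plane p))^*)).
  have kc : c <= r ^+ m.*2 by apply: lerXn => //; rewrite invr_ge0.
  have I20 : 0 <= I2 by apply: Rintegral_ge0 => p _; rewrite E sqr_ge0.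
  have I3M : I3 <= M.
    rewrite /I3 /M /Rintegral; apply: fine_le.
    - exact: integrable_fin_num i3.
    - exact: integrable_fin_num ig.
    apply: le_trans (_ : _ <= \int[dA R]_(p in pball r) (cabs (g (plane p)) ^+
      2)%:E)%E _.
      by rewrite le_eqVlt; apply/orP; left; apply/eqP;
        apply: eq_integral => p _; rewrite E.
    apply: ge0_subset_integral => //.
    - by case/integrableP: ig.
    - by move=> p _; rewrite lee_fin sqr_ge0.
  (* This integrates 2 c |g| |G| <= |g|^2 + c^2 |G|^2, after bounding the real part of conj(z)^m g
     conj(G) by |g| |G|. *)
  have key : (2 * c) * I1 <= I3 + c ^+ 2 * I2.
    rewrite -!RintegralZl// -RintegralD//; last first.
      by have := integrableZl mr (c ^+ 2) i2; apply: eq_integrable => // p _.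
    apply: le_Rintegral => //.
    - by have := integrableZl mr (2 * c) i1; apply: eq_integrable => // p _.
    - have := integrableD mr i3 (integrableZl mr (c ^+ 2) i2);
      apply: eq_integrable => // p _.
    move=> p pr; rewrite !E.
    have p1 : cabs (plane p) < 1 by exact: lt_trans rn1.
    have h : complex.Re (((plane p)^*) ^+ m * g (plane p) * (G (plane p))^*) <=
        cabs (g (plane p)) * cabs (G (plane p)).
      apply: le_trans (ler_norm _) _; apply: le_trans (ler_Re_cabs _) _.
      rewrite !cabsM cabsX !cabs_conj ler_wpM2r// ler_piMl//.
      exact (exprn_ile1 _ (cabs_ge0 _) (ltW p1)).
    have := sqr_ge0 (cabs (g (plane p)) - c * cabs (G (plane p))).
    have := ler_wpM2l (mulr_ge0 (ler0n R 2) (ltW c0)) h.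
    by rewrite sqrrB exprMn; lra.
  (* The moment identity gives [I1] = r^(2m) [I2] >= c [I2], hence 2 c^2 [I2] <= [I3] + c^2 [I2]. At
     radius r < 1 the integral [I2] is finite and can be cancelled. *)
  have fI2 : c ^+ 2 * I2 <= M.
    have : (2 * c) * (c * I2) <= I3 + c ^+ 2 * I2.
      apply: le_trans key; rewrite /I1 hs -/I2 ler_wpM2l//;
        first by rewrite mulr_ge0// ltW.
      by rewrite ler_wpM2r.
    by rewrite expr2; lra.
  have f2 := integrable_fin_num mr i2.
  rewrite (_ : (\int[dA R]_(p in pball r) (cabs (G (plane p)) ^+ 2)%:E)%E =
    I2%:E); last first.
    by rewrite /I2 /Rintegral fineK//; apply: eq_integral => p _; rewrite E.
  by rewrite lee_fin ler_pdivlMr ?exprn_gt0// mulrC.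
apply/(L2_diskP cG)/integrableP; split.
  by apply/measurable_EFinP; apply: measurable_cabs2.
apply: le_lt_trans (ltry (M / c ^+ 2)).
have -> : pball (1 : R) = \bigcup_n pball (inner_radius n).
  apply/seteqP; split => p; last by move=> [n _]; exact: pball_inner_radius_sub.
  by move=> p1; have [N /(_ N (leqnn _)) hN] := inner_radius_gt p1; exists N.
(* Monotone convergence over the growing disks carries the bound, which is independent of n, to the
   unit disk. *)
have cv : (\int[dA R]_(x in pball (inner_radius n)) `|(cabs (G (plane x)) ^+
  2)%:E| @[n --> \oo] -->
    \int[dA R]_(x in \bigcup_n pball (inner_radius n)) `|(cabs (G (plane x)) ^+
      2)%:E|)%E.
  apply: ge0_nondecreasing_set_cvg_integral.
  - move=> m' n mn; apply/subsetPset => p; rewrite /pball /= => h.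
    exact: lt_le_trans h (inner_radius_homo mn).
  - by move=> n; exact: measurable_pball.
  - move=> n; apply: measurableT_comp => //; apply/measurable_EFinP.
    by apply: measurable_cabs2 => //; case/andP: (inner_radius_lt n) => _ /ltW.
  - by move=> n p _; rewrite abse_ge0.
apply: (cvge_to_le cv); apply: nearW => n; apply: le_trans (bound n).
rewrite le_eqVlt; apply/orP; left; apply/eqP; apply: eq_integral => p _.
by rewrite /= ger0_norm ?sqr_ge0.
Qed.

(** Once G is in L2, both sides of [moment_identity_dA] converge as the radius grows, with r^(2m) ->
    1, and the two limits agree. *)
Lemma proj_orth m d (g G w : C -> C) : power_series d g ->
  power_series (proj_coef m d) G ->
  L2_disk g -> bergman w ->
  Rintegral (dA R) (pball 1) (fun p => complex.Re
    ((((plane p)^*) ^+ m * g (plane p) - G (plane p)) * (w (plane p))^*)) = 0.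
Proof.
move=> hg hG lg [aw lw]; have lG := proj_L2 hg hG lg.
have cg := analytic_disk_continuous (power_series_analytic hg).
have cG := analytic_disk_continuous (power_series_analytic hG).
have cw := analytic_disk_continuous aw.
have i1 := integrable_L2M (disk_continuousM (@disk_continuous_conjX m) cg) cw
  (L2_conjX m cg lg) lw.
have i2 := integrable_L2M cG cw lG lw.
have mp := measurable_pball (1 : R).
have h1 := Rintegral_pball_cvg i1.
have h2 := Rintegral_pball_cvg i2.
have h3 : inner_radius n ^+ m.*2 @[n --> \oo] --> (1 : R).
  rewrite -[X in _ --> X](expr1n _ m.*2).
  exact: (cvg_comp _ _ inner_radius_cvg (@exprn_continuous _ m.*2 1)).
have h4 := cvgM h3 h2; rewrite mul1r in h4.
pose A n := Rintegral (dA R) (pball (inner_radius n)) (fun p => complex.Re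
      (((plane p)^*) ^+ m * g (plane p) * (w (plane p))^*)).
have h5 : A @ \oo --> Rintegral (dA R) (pball 1) (fun p =>
  complex.Re (G (plane p) * (w (plane p))^*)).
  rewrite (_ : A = fun n => inner_radius n ^+ m.*2 * Rintegral (dA R) (pball
    (inner_radius n)) (fun p => complex.Re
      (G (plane p) * (w (plane p))^*))); first exact: h4.
  by apply/funext => n; exact: (moment_identity_dA n hg hG aw).
rewrite [LHS](_ : _ = Rintegral (dA R) (pball 1) (fun p =>
  complex.Re (((plane p)^*) ^+ m * g (plane p) * (w (plane p))^*)) -
   Rintegral (dA R) (pball 1) (fun p =>
     complex.Re (G (plane p) * (w (plane p))^*))).
  by apply/eqP; rewrite subr_eq0; apply/eqP; exact: (cvg_unique _ h1 h5).
rewrite -RintegralB//; apply: eq_Rintegral => p _.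
by rewrite mulrBl ReD ReN.
Qed.

(** If v z is not 0, then by continuity |v| >= |v z| / 2 on a small square around z, which has
    positive measure. *)
Lemma L2_eq0 (v : C -> C) : disk_continuous v ->
  (\int[dA R]_(p in pball 1) (cabs (v (plane p)) ^+ 2)%:E = 0)%E ->
  forall z, disk R z -> v z = 0.
Proof.
move=> cv h0 z /diskE z1; apply: contrapT => /eqP vz.
have v0 := cabs_gt0 vz; have v2 : 0 < cabs (v z) / 2 by lra.
have [d d0 hd] := cv z z1 _ v2.
(* Points of the square of half-side [e] are within 2 e of z, so they stay both in the neighbourhood
   of radius d and in the disk. *)
pose e := Num.min d (1 - cabs z) / 4.
have e0 : 0 < e by rewrite divr_gt0// lt_min d0 subr_gt0.
have [ed1 ed2] : e * 4 <= d /\ e * 4 <= 1 - cabs z.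
  by rewrite /e divfK//; split; rewrite ge_min lexx ?orbT.
pose Q := rect (complex.Re z - e) (complex.Re z +
  e) (complex.Im z - e) (complex.Im z + e).
have Qz p : Q p -> cabs (plane p - z) <= 2 * e.
  rewrite /Q /rect /= !in_itv /= => -[/andP[p1 p2] /andP[p3 p4]].
  apply: le_trans (ler_cabs_ReIm _) _; rewrite ReD ReN ImD ImN /=.
  have : `|p.1 - complex.Re z| <= e by rewrite ler_norml; lra.
  have : `|p.2 - complex.Im z| <= e by rewrite ler_norml; lra.
  lra.
have Q1 : Q `<=` pball 1.
  move=> p /Qz hp; suff : cabs (plane p) < 1 by [].
  by have := ler_sub_cabs (plane p) z; lra.
have mQ : measurable Q by exact: measurable_rect.
have := mulr_gt0 v2 v2; apply/negP; rewrite -leNgt.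
have mf : measurable_fun (pball 1) (fun p => (cabs (v (plane p)) ^+ 2)%:E).
  by apply/measurable_EFinP; exact: measurable_cabs2.
have mp := measurable_pball (1 : R).
have : (\int[dA R]_(p in Q) (cst (cabs (v z) / 2 * (cabs (v z) / 2))%:E p) <=
    \int[dA R]_(p in pball 1) (cabs (v (plane p)) ^+ 2)%:E)%E.
  have sQ : (\int[dA R]_(p in Q) (cabs (v (plane p)) ^+ 2)%:E <=
    \int[dA R]_(p in pball 1) (cabs (v (plane p)) ^+ 2)%:E)%E.
    by apply: ge0_subset_integral => // p _; rewrite lee_fin sqr_ge0.
  apply: le_trans _ sQ; apply: ge0_le_integral => //.
  - by move=> p _; rewrite /cst lee_fin mulr_ge0// ltW.
  - exact: (measurable_funS mp Q1 mf).
  move=> p /Qz hp; rewrite lee_fin -expr2; apply: lerXn; first exact: ltW.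
  have := hd (plane p - z) ltac:(lra); rewrite subrK cabs_sub.
  have := ler_sub_cabs (v z) (v (plane p)); lra.
rewrite h0 integral_cst//.
have -> : dA R Q = ((1 / pi) * (e * e * 4))%:E.
  rewrite /dA /= /mscale /= -/(area R Q) area_rect; [|lra|lra].
  by rewrite -EFinM; congr (_%:E); congr (_ * _); ring.
rewrite -EFinM lee_fin.
have e4 : 0 < 1 / pi * (e * e * 4) :> R by apply: mulr_gt0; [apply: divr_gt0;
  rewrite ?pi_gt0 | apply: mulr_gt0 => //; exact: mulr_gt0].
by rewrite pmulr_lle0.
Qed.

End Bergman.

(** * The Bergman projection *)

Section Projection.
Variable R : realType.
Local Notation C := (Cx R).

Lemma bergmanB (u v : C -> C) : bergman u -> bergman v ->
  bergman (fun z => u z - v z).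
Proof.
move=> [au lu] [av lv]; split; first by move=> z zd; apply: derivableB;
  [exact: au|exact: av].
have cu := analytic_disk_continuous au; have cv := analytic_disk_continuous av.
apply: (@L2_le R _ u v 2 (disk_continuousB cu cv) cu cv) => // z z1.
have h := ler_cabsB (u z) (v z).
apply: le_trans (lerXn 2 (cabs_ge0 _) h) _.
by have := sqr_ge0 (cabs (u z) - cabs (v z)); lra.
Qed.

Lemma bergmanD (u v : C -> C) : bergman u -> bergman v ->
  bergman (fun z => u z + v z).
Proof.
move=> [au lu] [av lv]; split; first by move=> z zd; apply: derivableD;
  [exact: au|exact: av].
have cu := analytic_disk_continuous au; have cv := analytic_disk_continuous av.
apply: (@L2_le R _ u v 2 (disk_continuousD cu cv) cu cv) => // z z1.
have h := ler_cabsD (u z) (v z).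
apply: le_trans (lerXn 2 (cabs_ge0 _) h) _.
by have := sqr_ge0 (cabs (u z) - cabs (v z)); lra.
Qed.

Lemma L2_bounded_mul (f u : C -> C) (M : R) : disk_continuous f ->
  disk_continuous u ->
  (forall z, cabs z < 1 -> cabs (f z) <= M) -> L2_disk u ->
    L2_disk (fun z => f z * u z).
Proof.
move=> cf cu fM lu; apply: (@L2_le R _ u u (M ^+ 2) (disk_continuousM cf cu) cu
  cu) => // z z1.
rewrite cabsM exprMn mulrDr; apply: le_trans (_ : M ^+ 2 * cabs (u z) ^+ 2 <=
  _).
  by rewrite ler_wpM2r ?sqr_ge0// lerXn// fM.
by rewrite lerDl mulr_ge0// sqr_ge0.
Qed.

Lemma bergman_bounded_mul (f u : C -> C) : Hinfty f -> bergman u ->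
  bergman (fun z => f z * u z).
Proof.
move=> [af [M fM]] [au lu]; split; first by move=> z zd; apply: derivableM;
  [exact: af|exact: au].
apply: (@L2_bounded_mul _ _ M) => //;
  [exact: analytic_disk_continuous|exact: analytic_disk_continuous|].
by move=> z /diskE /fM; rewrite cabsE lecR.
Qed.

Lemma L2_innerE (u w : C -> C) : L2_inner u w =
  (Rintegral (dA R) (pball 1) (fun p =>
    complex.Re (u (plane p) * (w (plane p))^*)) +i*
   Rintegral (dA R) (pball 1) (fun p =>
     complex.Im (u (plane p) * (w (plane p))^*)))%C.
Proof. by rewrite /L2_inner /disk_integral plane_diskE. Qed.

(** Testing against i w turns statements on real parts of inner products into statements on
    imaginary parts. *)
Lemma bergman_imul (w : C -> C) : bergman w -> bergman (fun z => 'i%C * w z).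
Proof.
move=> [aw lw]; split; first by move=> z zd; apply: derivableM;
  [exact: derivable_cst|exact: aw].
have cw := analytic_disk_continuous aw.
apply: (@L2_bounded_mul _ w 1 (@disk_continuous_cst R _) cw) => // z _.
by rewrite /cabs /= expr0n add0r expr1n sqrtr1.
Qed.

Lemma toeplitz_projection m (f g G : C -> C) (d : nat -> C) :
  Hinfty f -> bergman g -> power_series d g -> power_series (proj_coef m d) G ->
  is_bergman_projection (fun z => ((z^*) ^+ m + f z) * g z) (fun z =>
    G z + f z * g z).
Proof.
move=> hf hg hgd hG; split.
  apply: bergmanD; last exact: bergman_bounded_mul.
  by split; [exact: power_series_analytic hG | exact: proj_L2 hgd hG hg.2].
have E (w : C -> C) : bergman w ->
  Rintegral (dA R) (pball 1) (fun p => complex.Re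
    ((((plane p)^* ^+ m + f (plane p)) * g (plane p) - (G (plane p) +
      f (plane p) * g (plane p))) * (w (plane p))^*)) = 0.
  move=> hw; rewrite -[RHS](proj_orth hgd hG hg.2 hw);
    apply: eq_Rintegral => p _.
  by congr (complex.Re (_ * _)); rewrite mulrDl opprD addrACA subrr addr0.
move=> w hw; rewrite L2_innerE (E w hw).
(* The imaginary part of x conj(w) is the real part of x conj(i w). *)
rewrite (_ : Rintegral _ _ _ = 0)// -[RHS](E _ (bergman_imul hw)).
apply: eq_Rintegral => p _; move: (_ - _) => x; case: (w _) => s t;
  case: x => x y.
by rewrite /=; ring.
Qed.

(** Both orthogonality relations are tested against v1 - v2; their difference says that v1 - v2 has
    norm 0, and continuity makes it vanish everywhere on the disk. *)
Lemma bergman_projection_uniq (u v1 v2 : C -> C) : disk_continuous u ->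
  L2_disk u ->
  is_bergman_projection u v1 -> is_bergman_projection u v2 ->
  forall z, disk R z -> v1 z = v2 z.
Proof.
move=> cu lu [b1 h1] [b2 h2] z zd.
have c1 := analytic_disk_continuous b1.1;
  have c2 := analytic_disk_continuous b2.1.
have b12 := bergmanB b1 b2; have c12 := disk_continuousB c1 c2.
have L2B v : disk_continuous v -> L2_disk v -> L2_disk (fun z => u z - v z).
  move=> cv lv; apply: (@L2_le R _ u v 2 (disk_continuousB cu cv) cu cv) =>
    // x x1.
  apply: le_trans (lerXn 2 (cabs_ge0 _) (ler_cabsB (u x) (v x))) _.
  by have := sqr_ge0 (cabs (u x) - cabs (v x)); lra.
have re0 v : L2_inner (fun z => u z - v z) (fun z => v1 z - v2 z) = 0 ->
  Rintegral (dA R) (pball 1) (fun p =>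
    complex.Re ((u (plane p) - v (plane p)) * (v1 (plane p) - v2 (plane p))^*))
      = 0.
  by rewrite L2_innerE => /(congr1 (@complex.Re R)).
have i1 := integrable_L2M (disk_continuousB cu c1) c12 (L2B _ c1 b1.2) b12.2.
have i2 := integrable_L2M (disk_continuousB cu c2) c12 (L2B _ c2 b2.2) b12.2.
have mp := measurable_pball (1 : R).
have := RintegralB mp i2 i1; rewrite (re0 _ (h1 _ b12)) (re0 _ (h2 _ b12)) subrr
  => h.
apply/eqP; rewrite -subr_eq0; apply/eqP; move: z zd; apply: L2_eq0 => //.
have /(L2_diskP c12) i12 := b12.2.
rewrite -(fineK (integrable_fin_num mp i12)); congr (_%:E).
rewrite -[RHS]h; apply: eq_Rintegral => p _.
rewrite -ReN -ReD -mulrBl.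
have -> : u (plane p) - v2 (plane p) - (u (plane p) - v1 (plane p)) = v1 (plane
  p) - v2 (plane p) by ring.
by rewrite -sqr_cabsE.
Qed.

(** [toeplitz_projection] exhibits a projection, so [xget] returns one, and uniqueness identifies it
    on the disk. *)
Lemma toeplitzE m (f g G : C -> C) (d : nat -> C) :
  Hinfty f -> bergman g -> power_series d g -> power_series (proj_coef m d) G ->
  forall z, disk R z -> toeplitz (fun w =>
    (w^*) ^+ m + f w) g z = G z + f z * g z.
Proof.
move=> hf hg hgd hG; have hp := toeplitz_projection hf hg hgd hG.
have cf := analytic_disk_continuous hf.1;
  have cg := analytic_disk_continuous hg.1.
have cphi : disk_continuous (fun z =>
  (z^*) ^+ m + f z) by apply: disk_continuousD => //;
    exact: disk_continuous_conjX.
have cU := disk_continuousM cphi cg.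
have lU : L2_disk (fun z => ((z^*) ^+ m + f z) * g z).
  have [M fM] := hf.2.
  apply: (@L2_bounded_mul (fun z => (z^*) ^+ m + f z) g (1 + M) cphi cg) hg.2.
  move=> z z1; apply: le_trans (ler_cabsD _ _) _; apply: lerD.
    by rewrite cabsX cabs_conj; exact (exprn_ile1 _ (cabs_ge0 z) (ltW z1)).
  by have /diskE/fM := z1; rewrite cabsE lecR.
have hT : is_bergman_projection (fun z => ((z^*) ^+ m + f z) * g z)
    (toeplitz (fun w => (w^*) ^+ m + f w) g).
  by rewrite /toeplitz /bergman_projection; apply: xgetPex;
    exists (fun z => G z + f z * g z).
exact: (bergman_projection_uniq cU lU hT hp).
Qed.

Lemma eq_power_series_coef (a b : nat -> C) (u : C ->
  C) : (forall k, a k = b k) ->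
  power_series a u -> power_series b u.
Proof. by move=> /funext ->. Qed.

Lemma power_seriesB (a b : nat -> C) (u v : C -> C) : power_series a u ->
  power_series b v ->
  power_series (fun k => a k - b k) (fun z => u z - v z).
Proof.
move=> hu hv; have := power_seriesD hu (power_seriesZ (c := -1) hv).
rewrite (_ : (fun k => a k + -1 * b k) = (fun k => a k - b k));
  last by apply/funext => k; rewrite mulN1r.
by apply: eq_power_series => z _; rewrite mulN1r.
Qed.

Lemma power_series_euler (a : nat -> C) (u : C -> C) : power_series a u ->
  power_series (fun k => k%:R * a k) (fun z => z * derive1 u z).
Proof.
move=> /power_series_derive1/power_seriesX.
by rewrite (_ : (fun k => _) = (fun k => k%:R * a k))//;
  apply/funext => -[|k] //; rewrite mul0r.
Qed.

(** The equation g1 = z^m g2 leaves g2 undetermined at 0; continuity supplies the missing value,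
    tested at a small positive real. *)
Lemma disk_continuous_eq0 (v : C -> C) : disk_continuous v ->
  (forall z, disk R z -> z != 0 -> v z = 0) -> v 0 = 0.
Proof.
move=> cv v0; apply: cabs_eq0; apply/eqP; rewrite eq_le cabs_ge0 andbT.
apply/ler_addgt0Pr => e e0; rewrite add0r.
have z0 : cabs (0 : C) < 1 by rewrite cabs0.
have [d d0 hd] := cv 0 z0 e e0.
pose t : R := Num.min d 1 / 2.
have t0 : 0 < t by rewrite divr_gt0// lt_min d0 ltr01.
have [td t1] : t * 2 <= d /\ t * 2 <= 1.
  by rewrite /t divfK//; split; rewrite ge_min lexx ?orbT.
have ct : cabs ((t%:C)%C : C) = t by rewrite cabs_real gtr0_norm.
have := hd ((t%:C)%C) ltac:(rewrite ct; lra); rewrite addr0 v0.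
- by rewrite sub0r cabsN; exact: ltW.
- by apply/diskE; rewrite ct; lra.
- by apply/negP => /eqP tc; move: ct; rewrite tc cabs0; lra.
Qed.

End Projection.

(** * The equivalence of the four conditions *)

Theorem lemma3p5 (R : realType) (m : nat) (hm : (1 <= m)%N)
    (f g h : Cx R -> Cx R) (a d c : nat -> Cx R)
    (hf : Hinfty f) (hg : bergman g) (hh : bergman h)
    (hfa : power_series a f) (hgd : power_series d g) (hhc : power_series c h)
    (g0 g1 g2 : Cx R -> Cx R)
    (hg0 : forall z : Cx R, g0 z = \sum_(k < m) d k * z ^+ k)
    (hg1 : forall z : Cx R, disk R z -> g z = g0 z + g1 z)
    (hg2 : analytic g2)
    (hg12 : forall z : Cx R, disk R z -> g1 z = z ^+ m * g2 z) :
  let fg := fun z : Cx R => f z * g z in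
  let r := fun z : Cx R => fg z - h z in
  [<-> (forall z : Cx R, disk R z ->
          toeplitz (fun w => (w^*) ^+ m + f w) g z = h z);
       (forall z : Cx R, disk R z ->
          (z * derive1 g1 z - (m%:R - 1) * g1 z)
            + (m%:R + 1) * z ^+ m * r z + z ^+ m.+1 * derive1 r z = 0);
       (forall z : Cx R, disk R z ->
          (z * derive1 g2 z + g2 z) + (m%:R + 1) * fg z + z * derive1 fg z
            = (m%:R + 1) * h z + z * derive1 h z);
       (forall k : nat,
          c k = (k.+1)%:R / (m + k.+1)%:R * d (m + k)%N
                  + \sum_(i < k.+1) a (k - i)%N * d i)].
Proof.
move=> fg r.
have hfg : power_series (cauchy_prod a d) fg by exact: power_seriesM.
have hr : power_series (fun k => cauchy_prod a d k - c k) r by exact: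
  power_seriesB.
(* Of g2 only analyticity is assumed. Its expansion comes from the sum [G2] of the shifted series:
   the two agree off 0 after cancelling z^m, and at 0 by continuity. *)
have hg2d : power_series (fun k => d (m + k)%N) g2.
  have [G2 hG2] := subexp_power_series (subexp_shift m (power_series_subexp
    hgd)).
  have gG2 z : disk R z -> g z = g0 z + z ^+ m * G2 z.
    move: z; apply: power_series_uniq hgd _.
    have := power_seriesD (@power_series_poly _ m d) (@power_seriesXn _ m _ _
      hG2).
    rewrite (_ : (fun k => _ + _) = d).
      by apply: eq_power_series => z _; rewrite hg0.
    apply/funext => k; have [mk|km] := leqP m k; last by rewrite addr0.
    by rewrite add0r subnKC.
  have cD := disk_continuousB (analytic_disk_continuous hg2)
    (analytic_disk_continuous (power_series_analytic hG2)).
  have D0 z : disk R z -> z != 0 -> g2 z - G2 z = 0.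
    move=> zd z0; apply: (@mulfI _ (z ^+ m)); first by rewrite expf_neq0.
    rewrite mulr0 mulrBr; apply/eqP; rewrite subr_eq0 -hg12//; apply/eqP.
    by apply: (@addrI _ (g0 z)); rewrite -hg1// -gG2.
  apply: eq_power_series hG2 => z zd; apply/esym/eqP; rewrite -subr_eq0;
    apply/eqP.
  have [->|z0] := eqVneq z 0; last exact: D0.
  exact: (disk_continuous_eq0 cD D0).
have hg1d : power_series (fun k =>
  if (m <= k)%N then d (m + (k - m))%N else 0) g1.
  have := @power_seriesXn _ m _ _ hg2d.
  by apply: eq_power_series => z zd; rewrite hg12.
(* Condition (4) multiplied by m + k + 1; all four conditions are compared with this form. *)
pose Q := forall k, k.+1%:R * d (m + k)%N + (m%:R + 1 +
  k%:R) * (cauchy_prod a d k - c k) = 0.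
have mk0 k : (m + k.+1)%:R != 0 :> Cx R by rewrite addnS pnatr_eq0.
have mkE k : (m + k.+1)%:R = m%:R + 1 + k%:R :> Cx R by rewrite -addn1 !natrD;
  ring.
have q4 : (forall k, c k = (k.+1)%:R / (m + k.+1)%:R * d (m + k)%N
                  + \sum_(i < k.+1) a (k - i)%N * d i) <-> Q.
  split=> H k; have := H k; rewrite -/(cauchy_prod a d k).
    move=> ->; rewrite opprD addrCA subrr addr0 mulrN -mkE.
    by move: (mk0 k); move: ((m + k.+1)%:R) => s s0; field.
  rewrite -mkE; move: (mk0 k); move: ((m + k.+1)%:R : Cx R) => s s0 E.
  apply/eqP; rewrite -subr_eq0; apply/eqP; apply: (mulfI s0);
    rewrite mulr0 -[RHS]oppr0 -E.
  by field.
have q3 : (forall z : Cx R, disk R z ->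
          (z * derive1 g2 z + g2 z) + (m%:R + 1) * fg z + z * derive1 fg z
            = (m%:R + 1) * h z + z * derive1 h z) <-> Q.
  have s1 := power_seriesD (power_seriesD (power_seriesD (power_series_euler
    hg2d) hg2d)
     (power_seriesZ (c := m%:R + 1) hfg)) (power_series_euler hfg).
  have s2 := power_seriesD (power_seriesZ (c :=
    m%:R + 1) hhc) (power_series_euler hhc).
  have E k : k.+1%:R * d (m + k)%N + (m%:R + 1 +
    k%:R) * (cauchy_prod a d k - c k) =
     (k%:R * d (m + k)%N + d (m + k)%N + (m%:R + 1) * cauchy_prod a d k +
       k%:R * cauchy_prod a d k) -
     ((m%:R + 1) * c k + k%:R * c k) by rewrite -natr1; ring.
  split=> [H k|H z zd].
    by rewrite E (power_series_inj s1 s2 H k) subrr.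
  apply: (power_series_uniq s1 (eq_power_series_coef _ s2) zd) => k.
  by apply/esym/eqP; rewrite -subr_eq0 -E; apply/eqP.
have q2 : (forall z : Cx R, disk R z ->
          (z * derive1 g1 z - (m%:R - 1) * g1 z)
            + (m%:R + 1) * z ^+ m * r z + z ^+ m.+1 * derive1 r z = 0) <-> Q.
  have s := power_seriesD (power_seriesD (power_seriesB (power_series_euler
    hg1d)
     (power_seriesZ (c := m%:R - 1) hg1d)) (power_seriesZ (c :=
       m%:R + 1) (@power_seriesXn _ m _ _ hr)))
     (@power_seriesXn _ m _ _ (power_series_euler hr)).
  have E z : (z * derive1 g1 z - (m%:R - 1) * g1 z)
            + (m%:R + 1) * z ^+ m * r z + z ^+ m.+1 * derive1 r z =
     (z * derive1 g1 z - (m%:R - 1) * g1 z)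
            + (m%:R + 1) * (z ^+ m * r z) + z ^+ m * (z * derive1 r z) by
              rewrite exprSr !mulrA.
  split=> [H k|H z zd].
    have H' z : disk R z -> (z * derive1 g1 z - (m%:R - 1) * g1 z)
            + (m%:R + 1) * (z ^+ m * r z) + z ^+ m * (z * derive1 r z) = 0.
      by move=> zd; rewrite -E H.
    (* In degree m + k the first bracket contributes (m + k) - (m - 1) = k + 1 times d_(m+k). *)
    have := power_series_eq0 s H' (m + k)%N; rewrite leq_addr addKn natrD => <-.
    by rewrite -natr1; ring.
  have s0 : power_series (fun=> 0) (fun=> 0 : Cx R).
    by move=> x _; rewrite (_ : series _ = fun=> 0); [exact: cvg_cst |
      apply/funext => n; rewrite seriesEord /= big1// => i _; rewrite mul0r].
  rewrite E; apply: (power_series_uniq s (eq_power_series_coef _ s0) zd) => k.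
  (* Below degree m every coefficient is 0, because g1 and the shifted series start in degree m. *)
  case: leqP => mk; last by rewrite !mulr0 subrr !addr0.
  have kE : k%:R = m%:R + (k - m)%:R :> Cx R by rewrite -natrD subnKC.
  by rewrite -[LHS](H (k - m)%N) -natr1 kE; ring.
have q1 : (forall z : Cx R, disk R z ->
          toeplitz (fun w => (w^*) ^+ m + f w) g z = h z) <-> Q.
  rewrite -q4.
  (* By [toeplitzE] the Taylor coefficients of the Toeplitz image are exactly the right-hand sides
     of condition (4). *)
  have [G hG] := subexp_power_series (subexp_proj_coef m (power_series_subexp
    hgd)).
  have hT := toeplitzE hf hg hgd hG.
  have s := power_seriesD hG hfg.
  split=> [H k|H z zd].
    rewrite -(power_series_inj s hhc _ k)// => z zd.
    by rewrite -H// hT.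
  rewrite hT//; apply: (power_series_uniq s (eq_power_series_coef _ hhc) zd) =>
    k.
  by rewrite H.
tfae.
- by move=> /q1/q2.
- by move=> /q2/q3.
- by move=> /q3/q4.
- by move=> /q4/q1.
Qed.
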